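(* Let $m,n$ be two distinct square-free integers, both different from $1$, let $K=\mathbb{Q}(\sqrt{m},\sqrt{n})$ (a biquadratic number field), let $\mathfrak{p}$ be a prime ideal of $\mathcal{O}_K$ dividing $(2)$, and put $d=\gcd(m,n)$, $k=\frac{mn}{d^2}$. Then $s=s_4(K_{\mathfrak{p}})$ is one of $\{1,2,3,4,6,15\}$. Specifically, up to rearrangement of $m,n,k$ (i.e. after some permutation of the triple $(m,n,k)$ one of the following four cases applies, and whenever a permuted triple, again called $(m,n,k)$, satisfies the hypothesis of a case, the value of $s$ is as given there): (1) If $m\equiv 3$, $n\equiv k\equiv 2\pmod 4$, then - $s=1$ if ($32\mid n+k$ and $\frac{nk}{4}\equiv 15\pmod{16}$) or ($16\parallel n+k$ and $\frac{nk}{4}\equiv 7\pmod{16}$); - $s=2$ if ($32\mid n+k$ and $\frac{nk}{4}\equiv 7\pmod{16}$) or ($16\parallel n+k$ and $\frac{nk}{4}\equiv 15\pmod{16}$); - $s=3$ if $8\parallel n+k$; and one of these conditions holds. (2) If $m\equiv 1$, $n\equiv k\equiv 3\pmod 4$, then $s=4$ if $m\equiv 1\pmod 8$, and $s=2$ if $m\equiv 5\pmod 8$. (3) If $m\equiv 1$, $n\equiv k\equiv 2\pmod 4$, then $s=6$ if $m\equiv 1\pmod 8$, and $s=2$ if $m\equiv 5\pmod 8$. (4) If $m\equiv n\equiv k\equiv 1\pmod 4$, then $s=15$ if $m\equiv n\equiv k\equiv 1\pmod 8$, and $s=2$ otherwise.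
   Context: For a field $F$, the fourth level $s_4(F)$ is the smallest positive integer $g$ such that $x_1^4+\dots+x_g^4=-1$ is solvable in $F$ (and $s_4(F)=\infty$ if there is no such $g$). $\mathcal{O}_K$ is the ring of integers of $K$ and $K_{\mathfrak{p}}$ is the $\mathfrak{p}$-adic completion of $K$. For a power of two $2^j$ and an integer $N$, $2^j\parallel N$ means $2^j\mid N$ and $2^{j+1}\nmid N$. *)

(* Defs.v *)
From HB Require Import structures.
From mathcomp Require Import all_boot all_order all_algebra all_field.
From mathcomp Require Import boolp classical_sets.

Set Implicit Arguments.
Unset Strict Implicit.
Unset Printing Implicit Defensive.

Import Order.TTheory GRing.Theory Num.Theory.
Local Open Scope ring_scope.

(* 0 is not squarefree, and the sign is irrelevant. *)
Definition squarefree (m : int) : Prop :=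
  forall d : int, (d ^+ 2 %| m)%Z -> d \is a GRing.unit.

(* 2 ^ j || N *)
Definition exact_pow2 (j : nat) (N : int) : Prop :=
  ((2 ^+ j %| N)%Z /\ ~~ (2 ^+ j.+1 %| N)%Z).

Definition fourth_sum (F : fieldType) (g : nat) : Prop :=
  exists x : 'I_g -> F, \sum_(i < g) x i ^+ 4 = -1.

(* None stands for an infinite fourth level. *)
Definition fourth_level (F : fieldType) : option nat :=
  match pselect (exists g, (0 < g)%N && `[< fourth_sum F g >]) with
  | left ex => Some (ex_minn ex)
  | right _ => None
  end.

Section RingOfIntegers.
Variable K : fieldExtType rat.

Definition algint : {pred K} :=
  fun x => `[< integralOver (intr : int -> K) x >].

Lemma algintP x : reflect (integralOver (intr : int -> K) x) (x \in algint).
Proof. exact: asboolP. Qed.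

Lemma algint_subring_closed : subring_closed algint.
Proof.
split.
- by apply/algintP; apply: integral1.
- by move=> x y /algintP ix /algintP iy; apply/algintP; apply: integral_sub.
- by move=> x y /algintP ix /algintP iy; apply/algintP; apply: integral_mul.
Qed.

HB.instance Definition _ :=
  GRing.isSubringClosed.Build K algint algint_subring_closed.

Record ring_of_integers := RingOfIntegers {
  integer_val :> K;
  integer_valP : integer_val \in algint
}.

HB.instance Definition _ := [isSub for integer_val].
HB.instance Definition _ := [Choice of ring_of_integers by <:].
HB.instance Definition _ :=
  [SubChoice_isSubComNzRing of ring_of_integers by <:].

End RingOfIntegers.

Section Ideals.
Variable R : comNzRingType.
Implicit Types I J : set R.

(* Unlike idealr_closed, this allows the unit ideal. *)
Definition is_ideal I : Prop :=
  I 0 /\ forall a u v, I u -> I v -> I (a * u + v).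

Definition principal (a : R) : set R := [set r * a | r in [set: R]]%classic.

Definition idealM I J : set R :=
  [set x | exists s : seq (R * R),
     (forall u, u \in s -> I u.1 /\ J u.2) /\ x = \sum_(u <- s) u.1 * u.2]%classic.

Definition idealX I (n : nat) : set R := iter n (idealM I) [set: R]%classic.

Definition ideal_dvd I J : Prop := exists H, is_ideal H /\ idealM I H = J.

(* a is in I ^ n but not in I ^ n.+1 *)
Definition ideal_ord I (a : R) (n : nat) : Prop :=
  idealX I n a /\ ~ idealX I n.+1 a.

End Ideals.

(* v_p(x) = z, computed on any presentation of x <> 0 as a fraction of
   algebraic integers. *)
Definition padic_val (K : fieldExtType rat) (p : set (ring_of_integers K))
    (x : K) (z : int) : Prop :=
  exists (a b : ring_of_integers K) (i j : nat),
    [/\ b != 0, x = (a : K) / (b : K), ideal_ord p a i, ideal_ord p b j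
      & z = i%:Z - j%:Z].

Section Completion.
Variables (L : fieldType) (v : L -> int).

(* The value v 0 is irrelevant: 0 has infinite valuation. *)
Definition val_ge (x : L) (N : int) : Prop := x = 0 \/ N <= v x.

Definition is_valuation : Prop :=
  (forall x y, x != 0 -> y != 0 -> v (x * y) = v x + v y) /\
  (forall x y N, val_ge x N -> val_ge y N -> val_ge (x + y) N).

Definition val_cauchy (u : nat -> L) : Prop :=
  forall N : int, exists n0 : nat, forall i j : nat,
    (n0 <= i)%N -> (n0 <= j)%N -> val_ge (u i - u j) N.

Definition val_cvg (u : nat -> L) (l : L) : Prop :=
  forall N : int, exists n0 : nat, forall i : nat,
    (n0 <= i)%N -> val_ge (u i - l) N.

Definition val_complete : Prop :=
  forall u, val_cauchy u -> exists l, val_cvg u l.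

End Completion.

(* The valued field (L, v), with the embedding iota, is the completion K_p:
   it is complete, its valuation extends v_p, and K is dense in it.  This
   determines (L, v, iota) up to a unique isomorphism. *)
Definition is_padic_completion (K : fieldExtType rat)
    (p : set (ring_of_integers K))
    (L : fieldType) (v : L -> int) (iota : {rmorphism K -> L}) : Prop :=
  [/\ is_valuation v,
      val_complete v,
      (forall (x : K) (z : int), x != 0 -> (v (iota x) = z <-> padic_val p x z))
    & (forall (y : L) (N : int), exists x : K, val_ge v (y - iota x) N)].

(* Main.v *)
(**
  A 2-adic unit that is 1 mod 8 is a square, so up to isomorphism K_p depends
  only on the square classes of m and n over Q_2, and it is one of finitely
  many fields Q_2(x, y).  In each of them x and y can be chosen so that
  either K_p is totally ramified over Q_2 with ring of integers Z_2[x, y], or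
  K_p contains sqrt(-3).

  In the totally ramified fields, 1 + 16 O consists of fourth powers, and
  z^4 mod 16 depends only on z mod 4; hence the upper bounds come from
  explicit solutions mod 16 and the lower bounds from a finite enumeration
  mod 16 (a solution with a non-integral entry is made integral by dividing
  by the entry of least valuation, because -1 is itself minus a fourth power).

  If K_p contains sqrt(-3), then -1 = w^4 + w^8 for a primitive cube root of
  unity w.  A solution of x^4 = -1 would give v(x - 1) = v(2) / 4, but in
  these fields the ramification index is at most 2.
*)
From HB Require Import structures.
Require Import Defs.
From mathcomp Require Import all_boot all_order all_algebra all_field.
From mathcomp Require Import boolp classical_sets.
From mathcomp Require Import zify ring.

Set Implicit Arguments.
Unset Strict Implicit.
Unset Printing Implicit Defensive.

Import Order.TTheory GRing.Theory Num.Theory.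
Local Open Scope ring_scope.

(** * Congruences of integers *)

(** Neither the local degree nor a ring of integers is ever computed. All that is kept of [K] is
    that 1 and the square roots of [a], [b], [c] have a dense span over Q_2 and that [a b c] is a
    square. These roots may well be dependent, as they are when the local degree drops. Integrality
    is instead read off valuations: if the valuations of the generators lie in [0, v(2)) and are
    distinct modulo v(2), then a combination is divisible by a power of 2 only if its coordinates
    are. The obvious generators fail this test for the levels 2 and 3 of case (1): with [x] the root
    of the odd radicand and [b] that of an even one, [1 + x] and [b] both have valuation v(2)/2.
    Their product divided by 2 is a unit [y], and [y - 1] has valuation v(2)/4, which supplies the
    missing quarter steps. The valuation is not assumed normalised, so every bound is expressed in
    units of v(2). Density is enough throughout, since only residues modulo 4 or 16 and leading
    valuations are ever examined. *)

Lemma int_pow2_odd (n : int) :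
  n != 0 -> exists (s : nat) (w : int), n = 2 ^+ s * (2 * w + 1).
Proof.
have [k] := ubnP `|n|%N; elim: k n => // k IH n le_nk n0.
have nE := divz_eq n 2.
have [r0|r1] : (n %% 2)%Z = 0 \/ (n %% 2)%Z = 1 by lia.
  have [||s [w sE]] := IH (n %/ 2)%Z; try lia.
  by exists s.+1, w; rewrite exprS -mulrA -sE; lia.
by exists 0, (n %/ 2)%Z; rewrite mul1r; lia.
Qed.

Lemma odd_mod16 (b : int) : (b %% 2)%Z = 1 -> exists k r : int,
  b = 16 * k + r /\ r \in [:: 1; 3; 5; 7; -1; -3; -5; -7].
Proof.
move=> b2; exists ((b + 8) %/ 16)%Z, (((b + 8) %% 16)%Z - 8); split; first by lia.
by rewrite !inE; lia.
Qed.

(** Turns the conditions on [b + c] into residues that fix 2-adic square classes. Both sides depend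
    only on [b / 2] and [c / 2] modulo 16, which leaves 64 pairs. For the last clause, two odd
    residues with product 3 modulo 8 are {1, 3} or {5, 7}, so one of them is 1 or -1. *)
Lemma case1_arith (b c : int) : (b = 2 %[mod 4])%Z -> (c = 2 %[mod 4])%Z ->
  [/\ ((32 %| b + c)%Z /\ (((b * c) %/ 4)%Z = 15 %[mod 16])%Z) \/
      (exact_pow2 4 (b + c) /\ (((b * c) %/ 4)%Z = 7 %[mod 16])%Z) <->
      (((b * c) %/ 4)%Z = 7 %[mod 8])%Z /\ ((b = 2 %[mod 16])%Z \/ (b = -2 %[mod 16])%Z),
      ((32 %| b + c)%Z /\ (((b * c) %/ 4)%Z = 7 %[mod 16])%Z) \/
      (exact_pow2 4 (b + c) /\ (((b * c) %/ 4)%Z = 15 %[mod 16])%Z) <->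
      (((b * c) %/ 4)%Z = 7 %[mod 8])%Z /\ ((b = 6 %[mod 16])%Z \/ (b = -6 %[mod 16])%Z),
      exact_pow2 3 (b + c) <-> (((b * c) %/ 4)%Z = 3 %[mod 8])%Z
    & (((b * c) %/ 4)%Z = 3 %[mod 8])%Z ->
      ((b = 2 %[mod 16])%Z \/ (b = -2 %[mod 16])%Z) \/
      ((c = 2 %[mod 16])%Z \/ (c = -2 %[mod 16])%Z)].
Proof.
move=> b2 c2.
have [|k [r [bE rM]]] := @odd_mod16 (b %/ 2)%Z; first by lia.
have [|l [s [cE sM]]] := @odd_mod16 (c %/ 2)%Z; first by lia.
have {}bE : b = 32 * k + 2 * r by lia.
have {}cE : c = 32 * l + 2 * s by lia.
have -> : ((b * c) %/ 4)%Z = 16 * (16 * k * l + k * s + r * l) + r * s.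
  by rewrite bE cE; lia.
have -> : b + c = 32 * (k + l) + 2 * (r + s) by lia.
have -> : ((b = 2 %[mod 16])%Z) = ((r = 1 %[mod 8])%Z) by apply/propext; lia.
have -> : ((b = -2 %[mod 16])%Z) = ((r = -1 %[mod 8])%Z) by apply/propext; lia.
have -> : ((b = 6 %[mod 16])%Z) = ((r = 3 %[mod 8])%Z) by apply/propext; lia.
have -> : ((b = -6 %[mod 16])%Z) = ((r = -3 %[mod 8])%Z) by apply/propext; lia.
have -> : ((c = 2 %[mod 16])%Z) = ((s = 1 %[mod 8])%Z) by apply/propext; lia.
have -> : ((c = -2 %[mod 16])%Z) = ((s = -1 %[mod 8])%Z) by apply/propext; lia.
move: (k + l) (16 * k * l + _ + _) => m q; clear -rM sM.
rewrite /exact_pow2.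
rewrite -[2 ^+ 3]/(8 : int) -[2 ^+ 4]/(16 : int) -[2 ^+ 5]/(32 : int).
move: rM sM; rewrite !inE.
move=> /or4P[/eqP->|/eqP->|/eqP->|/or4P[/eqP->|/eqP->|/eqP->|/orP[/eqP->|/eqP->]]];
move=> /or4P[/eqP->|/eqP->|/eqP->|/or4P[/eqP->|/eqP->|/eqP->|/orP[/eqP->|/eqP->]]].
all: split; lia.
Qed.

Lemma sqr_mod8 (t : int) :
  [\/ (t ^+ 2 = 0 %[mod 8])%Z, (t ^+ 2 = 1 %[mod 8])%Z | (t ^+ 2 = 4 %[mod 8])%Z].
Proof.
have tE : t ^+ 2 = 8 * (2 * (t %/ 4)%Z ^+ 2 + (t %/ 4)%Z * (t %% 4)%Z) + (t %% 4)%Z ^+ 2.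
  by rewrite {1}(divz_eq t 4); ring.
rewrite tE; move: (_ + _ * (t %% 4)%Z) => q.
have [->|[->|[->|->]]] : (t %% 4)%Z = 0 \/ (t %% 4)%Z = 1 \/ (t %% 4)%Z = 2 \/
    (t %% 4)%Z = 3 by lia.
- by apply: Or31; lia.
- by apply: Or32; lia.
- by apply: Or33; lia.
- by apply: Or32; lia.
Qed.

Lemma mod8M (a b : int) : ((a * b) %% 8)%Z = (((a %% 8)%Z * (b %% 8)%Z) %% 8)%Z.
Proof. by rewrite modzMmr modzMml. Qed.

(** [a] times [b c / 4] is an odd square, hence 1 modulo 8, and every odd residue is its own inverse
    modulo 8. *)
Lemma case1_mod8 (a b c t : int) :
  (a = 3 %[mod 4])%Z -> (b = 2 %[mod 4])%Z -> (c = 2 %[mod 4])%Z ->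
  a * b * c = t ^+ 2 -> (((b * c) %/ 4)%Z = a %[mod 8])%Z.
Proof.
move=> a3 b2 c2 E.
pose b' := (b %/ 2)%Z; pose c' := (c %/ 2)%Z; pose t' := (t %/ 2)%Z.
have bE : b = 2 * b' by rewrite /b'; lia.
have cE : c = 2 * c' by rewrite /c'; lia.
have b1 : (b' %% 2)%Z = 1 by rewrite /b'; lia.
have c1 : (c' %% 2)%Z = 1 by rewrite /c'; lia.
have tE : t = 2 * t'.
  have [|t1] : (t %% 2)%Z = 0 \/ t = 2 * t' + 1 by rewrite /t'; lia.
    by rewrite /t'; lia.
  have E1 : a * b * c = 2 * (a * b' * c) by rewrite bE; ring.
  have E2 : t ^+ 2 = 2 * (2 * (t' ^+ 2 + t')) + 1 by rewrite t1; ring.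
  by move: E; rewrite E1 E2; lia.
have {}E : a * b' * c' = t' ^+ 2.
  have E1 : a * b * c = 4 * (a * b' * c') by rewrite bE cE; ring.
  have E2 : t ^+ 2 = 4 * t' ^+ 2 by rewrite tE; ring.
  by move: E; rewrite E1 E2; lia.
have -> : ((b * c) %/ 4)%Z = b' * c'.
  have -> : b * c = 4 * (b' * c') by rewrite bE cE; ring.
  by lia.
have := sqr_mod8 t'; rewrite -E => {}E.
move: E; rewrite mod8M [(a * b' %% 8)%Z]mod8M [(b' * c' %% 8)%Z]mod8M.
have [->|->] : (a %% 8)%Z = 3 \/ (a %% 8)%Z = 7 by lia.
all: have [->|[->|[->|->]]] : (b' %% 8)%Z = 1 \/ (b' %% 8)%Z = 3 \/ (b' %% 8)%Z = 5 \/
  (b' %% 8)%Z = 7 by lia.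
all: have [->|[->|[->|->]]] : (c' %% 8)%Z = 1 \/ (c' %% 8)%Z = 3 \/ (c' %% 8)%Z = 5 \/
  (c' %% 8)%Z = 7 by lia.
all: by case.
Qed.

(** The odd square [a b c] is 1 modulo 8, so the residue 5 occurs an even number of times. *)
Lemma case4_mod8 (a b c t : int) :
  (a = 1 %[mod 4])%Z -> (b = 1 %[mod 4])%Z -> (c = 1 %[mod 4])%Z ->
  a * b * c = t ^+ 2 ->
  [\/ [/\ (a = 1 %[mod 8])%Z, (b = 1 %[mod 8])%Z & (c = 1 %[mod 8])%Z],
      [/\ (a = 1 %[mod 8])%Z, (b = 5 %[mod 8])%Z & (c = 5 %[mod 8])%Z],
      [/\ (a = 5 %[mod 8])%Z, (b = 1 %[mod 8])%Z & (c = 5 %[mod 8])%Z]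
    | [/\ (a = 5 %[mod 8])%Z, (b = 5 %[mod 8])%Z & (c = 1 %[mod 8])%Z]].
Proof.
move=> a1 b1 c1 E.
have := sqr_mod8 t; rewrite -E mod8M [((a * b) %% 8)%Z]mod8M.
have [aE|aE] : (a %% 8)%Z = 1 \/ (a %% 8)%Z = 5 by lia.
all: have [bE|bE] : (b %% 8)%Z = 1 \/ (b %% 8)%Z = 5 by lia.
all: have [cE|cE] : (c %% 8)%Z = 1 \/ (c %% 8)%Z = 5 by lia.
all: rewrite aE bE cE; case=> // _.
- by apply: Or41.
- by apply: Or42.
- by apply: Or43.
- by apply: Or44.
Qed.

(** * Fourth powers modulo 16 *)

(* Coordinates of [(a + b x) + (c + d x) y], where [x ^+ 2 = A] and
   [y ^+ 2 = B0 + B1 x]. *)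
Definition coords : Type := (int * int) * (int * int).

(** [p + q x] is [(c + d x) ^+ 2], the factor that multiplies [y ^+ 2]. *)
Definition coords_sqr (A B0 B1 : int) (t : coords) : coords :=
  let: ((a, b), (c, d)) := t in
  let p := c * c + A * (d * d) in let q := 2 * c * d in
  ((a * a + A * (b * b) + p * B0 + A * q * B1, 2 * a * b + p * B1 + q * B0),
   (2 * (a * c + A * (b * d)), 2 * (a * d + b * c))).

Definition coords_mod16 (t : coords) : coords :=
  (((t.1.1 %% 16)%Z, (t.1.2 %% 16)%Z), ((t.2.1 %% 16)%Z, (t.2.2 %% 16)%Z)).

Definition coords_pow4 A B0 B1 (t : coords) : coords :=
  coords_mod16 (coords_sqr A B0 B1 (coords_mod16 (coords_sqr A B0 B1 t))).

Definition digits (b : bool) : seq int := if b then [:: 0; 1; 2; 3] else [:: 0].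

Definition box (bx bz : bool) : seq coords :=
  [seq (p, q) | p <- [seq (a, b) | a <- digits true, b <- digits bx],
                q <- [seq (c, d) | c <- digits bz, d <- digits bz]].

Definition coords_null (bx bz : bool) (t : coords) : bool :=
  [&& (t.1.1 %% 16)%Z == 0, bx ==> ((t.1.2 %% 16)%Z == 0)
    & bz ==> ((t.2.1 %% 16)%Z == 0) && ((t.2.2 %% 16)%Z == 0)].

Fixpoint no_null_sum (P : seq coords) (test : pred coords) (g : nat) (t : coords) :=
  if g is g'.+1 then all (fun p => no_null_sum P test g' (t + p)) P else ~~ test t.

(** The accumulator starts at 1, so the test asks whether 1 plus [g] fourth powers can vanish modulo
    16. [undup] keeps the search small: over Q_2 only the powers 0 and 1 remain, and 14 summands
    cost 2 ^ 14 branches. *)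
Definition no_fourth_sum_mod16 A B0 B1 bx bz g :=
  no_null_sum (undup (map (coords_pow4 A B0 B1) (box bx bz)))
    (coords_null bx bz) g ((1, 0), (0, 0)).

Lemma Q2_check : no_fourth_sum_mod16 0 0 0 false false 14.
Proof. by vm_compute. Qed.

Lemma Q2_sqrtN1_check : no_fourth_sum_mod16 (-1) 0 0 true false 3.
Proof. by vm_compute. Qed.

Lemma Q2_sqrt3_check : no_fourth_sum_mod16 3 0 0 true false 3.
Proof. by vm_compute. Qed.

Lemma Q2_sqrt_even_check (A : int) : A \in [:: 2; -2; 6; -6] ->
  no_fourth_sum_mod16 A 0 0 true false 5.
Proof. by rewrite !inE => /or4P[] /eqP ->; vm_compute. Qed.

Lemma Q2_sqrtN1_sqrt6_check (B1 : int) : B1 \in [:: 3; -3] ->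
  no_fourth_sum_mod16 (-1) 0 B1 true true 1.
Proof. by rewrite !inE => /orP[] /eqP ->; vm_compute. Qed.

Lemma Q2_sqrt3_sqrt2_check (s : int) : s \in [:: 1; -1] ->
  no_fourth_sum_mod16 3 (2 * s) s true true 2.
Proof. by rewrite !inE => /orP[] /eqP ->; vm_compute. Qed.

(** * Fourth levels of an arbitrary field *)

Lemma fourth_sum0 (F : fieldType) : ~ fourth_sum F 0.
Proof.
by move=> [x]; rewrite big_ord0 => /eqP; rewrite eq_sym oppr_eq0 oner_eq0.
Qed.

Lemma fourth_sumS (F : fieldType) g : fourth_sum F g -> fourth_sum F g.+1.
Proof.
move=> [x xE]; exists (fun i => oapp x 0 (unlift ord0 i)).
rewrite big_ord_recl unlift_none /= expr0n add0r -xE.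
by apply: eq_bigr => i _; rewrite liftK.
Qed.

Lemma fourth_level_eq (F : fieldType) g :
  fourth_sum F g.+1 -> ~ fourth_sum F g -> fourth_level F = Some g.+1.
Proof.
move=> sg nsg; rewrite /fourth_level; case: pselect => [ex|[]]; last first.
  by exists g.+1; apply/asboolP.
congr Some; case: ex_minnP => k /andP[_ /asboolP sk] kmin.
apply/eqP; rewrite eqn_leq kmin /=; last exact/asboolP.
rewrite ltnNge; apply/negP => /subnK kg; apply: nsg; rewrite -kg.
by elim: (g - k)%N => // j; apply: fourth_sumS.
Qed.

Lemma fourth_sum_seq (F : fieldType) (s : seq F) :
  \sum_(x <- s) x ^+ 4 = -1 -> fourth_sum F (size s).
Proof. by exists (fun i => s`_i); rewrite (big_nth 0) big_mkord in H *. Qed.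

(** The case table of the theorem with the level and the triple abstracted, so that it can be proved
    for every ordering of the radicands; it is convertible to the wording of the theorem. *)
Definition level_spec (s : option nat) (a b c : int) : Prop :=
  let cong4 (a b c r1 r2 r3 : int) :=
    [/\ (a = r1 %[mod 4])%Z, (b = r2 %[mod 4])%Z & (c = r3 %[mod 4])%Z] in
  let case1_s1 (b c : int) :=
    ((32 %| b + c)%Z /\ (((b * c) %/ 4)%Z = 15 %[mod 16])%Z) \/
    (exact_pow2 4 (b + c) /\ (((b * c) %/ 4)%Z = 7 %[mod 16])%Z) in
  let case1_s2 (b c : int) :=
    ((32 %| b + c)%Z /\ (((b * c) %/ 4)%Z = 7 %[mod 16])%Z) \/
    (exact_pow2 4 (b + c) /\ (((b * c) %/ 4)%Z = 15 %[mod 16])%Z) in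
  let case1_s3 (b c : int) := exact_pow2 3 (b + c) in
  [/\ cong4 a b c 3 2 2 ->
        [/\ case1_s1 b c -> s = Some 1%N,
            case1_s2 b c -> s = Some 2%N,
            case1_s3 b c -> s = Some 3%N
          & [\/ case1_s1 b c, case1_s2 b c | case1_s3 b c]],
      cong4 a b c 1 3 3 ->
        ((a = 1 %[mod 8])%Z -> s = Some 4%N) /\
        ((a = 5 %[mod 8])%Z -> s = Some 2%N),
      cong4 a b c 1 2 2 ->
        ((a = 1 %[mod 8])%Z -> s = Some 6%N) /\
        ((a = 5 %[mod 8])%Z -> s = Some 2%N)
    & cong4 a b c 1 1 1 ->
        let all1mod8 :=
          [/\ (a = 1 %[mod 8])%Z, (b = 1 %[mod 8])%Z
            & (c = 1 %[mod 8])%Z] in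
        (all1mod8 -> s = Some 15%N) /\ (~ all1mod8 -> s = Some 2%N)].

Lemma level_spec_mem s a b c :
  [\/ (a = 3 %[mod 4])%Z /\ (b = 2 %[mod 4])%Z /\ (c = 2 %[mod 4])%Z,
      (a = 1 %[mod 4])%Z /\ (b = 3 %[mod 4])%Z /\ (c = 3 %[mod 4])%Z,
      (a = 1 %[mod 4])%Z /\ (b = 2 %[mod 4])%Z /\ (c = 2 %[mod 4])%Z
    | (a = 1 %[mod 4])%Z /\ (b = 1 %[mod 4])%Z /\ (c = 1 %[mod 4])%Z] ->
  level_spec s a b c -> s \in [:: Some 1; Some 2; Some 3; Some 4; Some 6; Some 15]%N.
Proof.
have mem n : n \in [:: 1; 2; 3; 4; 6; 15]%N ->
    Some n \in [:: Some 1; Some 2; Some 3; Some 4; Some 6; Some 15]%N.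
  exact: map_f.
move=> h [s1 s2 s3 s4]; case: h => -[a4 [b4 c4]].
- by have [//|e1 e2 e3 [/e1|/e2|/e3] ->] := s1; apply: mem.
- have [//|e1 e2] := s2.
  have a15 : (a = 1 %[mod 8])%Z \/ (a = 5 %[mod 8])%Z by lia.
  by case: a15 => [/e1|/e2] ->; apply: mem.
- have [//|e1 e2] := s3.
  have a15 : (a = 1 %[mod 8])%Z \/ (a = 5 %[mod 8])%Z by lia.
  by case: a15 => [/e1|/e2] ->; apply: mem.
- have [//|e1 e2] := s4; set P := (X in X -> s = _) in e1.
  by have [/e1|/e2] := EM P => ->; apply: mem.
Qed.

(** * Complete valued fields of residue characteristic 2 *)

Section Valuation.
Variables (L : fieldType) (v : L -> int).
Hypothesis v_val : is_valuation v.
Hypothesis two_neq0 : (2 : L) != 0.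
Hypothesis v2_gt0 : 0 < v 2.
Hypothesis v_complete : val_complete v.
Implicit Types (x y z : L) (N : int).

Local Notation vge := (val_ge v).
Local Notation e := (v 2).

Lemma valM x y : x != 0 -> y != 0 -> v (x * y) = v x + v y.
Proof. exact: v_val.1. Qed.

Lemma val1 : v 1 = 0.
Proof.
have h : v 1 = v 1 + v 1 by rewrite -valM ?oner_neq0 ?mulr1.
by lia.
Qed.

Lemma valN x : v (- x) = v x.
Proof.
have [->|x0] := eqVneq x 0; first by rewrite oppr0.
have m0 : (-1 : L) != 0 by rewrite oppr_eq0 oner_eq0.
have h : v (-1) + v (-1) = 0 by rewrite -valM // mulrNN mulr1 val1.
by rewrite -mulN1r valM //; lia.
Qed.

Lemma valV x : x != 0 -> v x^-1 = - v x.
Proof.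
move=> x0; have h : v x + v x^-1 = 0 by rewrite -valM ?invr_neq0 ?divff ?val1.
by lia.
Qed.

Lemma valX x k : x != 0 -> v (x ^+ k) = k%:Z * v x.
Proof.
move=> x0; elim: k => [|k IH]; first by rewrite expr0 val1; lia.
by rewrite exprS valM ?expf_neq0 // IH; lia.
Qed.

Lemma vgeE x N : x != 0 -> vge x N = (N <= v x).
Proof.
move=> x0; apply/propext; split => [[x0'|//]|]; last by right.
by rewrite x0' eqxx in x0.
Qed.

Lemma vgeD x y N : vge x N -> vge y N -> vge (x + y) N.
Proof. exact: v_val.2. Qed.

Lemma vgeN x N : vge x N -> vge (- x) N.
Proof. by case=> [->|h]; [rewrite oppr0; left|right; rewrite valN]. Qed.

Lemma vgeB x y N : vge x N -> vge y N -> vge (x - y) N.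
Proof. by move=> hx hy; apply: vgeD => //; apply: vgeN. Qed.

Lemma vgeBC x y N : vge (x - y) N -> vge (y - x) N.
Proof. by move=> /vgeN; rewrite opprB. Qed.

Lemma vge_trans y x z N : vge (x - y) N -> vge (y - z) N -> vge (x - z) N.
Proof. by move=> h1 h2; rewrite -(subrKA y x); apply: vgeD. Qed.

Lemma vgeW N x N' : N' <= N -> vge x N -> vge x N'.
Proof. by move=> le [->|h]; [left|right; apply: le_trans le h]. Qed.

Lemma vgeM x y N N' : vge x N -> vge y N' -> vge (x * y) (N + N').
Proof.
move=> [->|hx]; first by rewrite mul0r; left.
move=> [->|hy]; first by rewrite mulr0; left.
have [->|x0] := eqVneq x 0; first by rewrite mul0r; left.
have [->|y0] := eqVneq y 0; first by rewrite mulr0; left.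
by right; rewrite valM //; lia.
Qed.

Lemma vgeX x k : vge x 0 -> vge (x ^+ k) 0.
Proof.
move=> hx; elim: k => [|k IH]; first by right; rewrite val1.
by rewrite exprS; apply: (vgeM hx IH).
Qed.

Lemma vgeO x y : vge x 0 -> vge y 0 -> vge (x * y) 0.
Proof. exact: vgeM. Qed.

Lemma vgeMl x y N : vge x 0 -> vge y N -> vge (x * y) N.
Proof. by move=> hx hy; rewrite -[N]add0r; apply: vgeM. Qed.

Lemma vge_sqr x N : vge (x ^+ 2) (2 * N) -> vge x N.
Proof.
have [->|x0] := eqVneq x 0; first by left.
by rewrite !vgeE ?expf_neq0 // valX //; lia.
Qed.

Lemma vge_nat k : vge k%:R 0.
Proof.
elim: k => [|k IH]; first by left.
by rewrite -natr1; apply: vgeD => //; right; rewrite val1.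
Qed.

Lemma vge_int (c : int) : vge c%:~R 0.
Proof.
by case: c => c; rewrite ?NegzE ?mulrNz; [|apply: vgeN]; apply: vge_nat.
Qed.

Lemma vge_small x : (forall N, vge x N) -> x = 0.
Proof. by move=> h; have [//|] := h (v x + 1); lia. Qed.

(** The term of strictly smaller valuation dominates. The bound on [y] goes through [N] rather than
    [v y] so that [y = 0], where [v] is arbitrary, is included. *)
Lemma vgeDN0 x y N : x != 0 -> v x < N -> vge y N ->
  x + y != 0 /\ v (x + y) = v x.
Proof.
move=> x0 vx hy.
have xy0 : x + y != 0.
  apply/eqP => xy0; have : vge x N by rewrite -[x](addrK y) xy0 sub0r; apply: vgeN.
  by rewrite vgeE //; lia.
split=> //.
have h1 : vge (x + y) (v x) by apply: vgeD; [right|apply: vgeW hy; lia].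
have h2 : vge (x + y - y) (Num.min N (v (x + y))).
  apply: vgeB; first by right; rewrite ge_min lexx orbT.
  by apply: vgeW hy; rewrite ge_min lexx.
move: h1 h2; rewrite addrK !vgeE // ge_min => h1 /orP[]; lia.
Qed.

Lemma val_eq x y N : x != 0 -> v x < N -> vge (y - x) N -> y != 0 /\ v y = v x.
Proof. by move=> x0 h1 h2; rewrite -(subrKC x y); apply: vgeDN0 h1 h2. Qed.

Lemma vge_split x y N : (x != 0 -> y != 0 -> v x <> v y) ->
  vge (x + y) N -> vge x N /\ vge y N.
Proof.
have [->|x0] := eqVneq x 0; first by rewrite add0r => _ h; split=> //; left.
have [->|y0] := eqVneq y 0; first by rewrite addr0 => _ h; split=> //; left.
move=> /(_ isT isT) nxy.
have [lt|le] := ltP (v x) (v y).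
  have [s0 sE] := vgeDN0 x0 lt (or_intror (lexx _)).
  by rewrite !vgeE // sE; lia.
have lt : v y < v x by lia.
have [s0 sE] := vgeDN0 y0 lt (or_intror (lexx _)).
by rewrite addrC !vgeE // sE; lia.
Qed.

Lemma vge_pow2 k : vge (2 ^+ k) (k%:Z * e).
Proof. by right; rewrite valX. Qed.

Lemma vge_pow2M k x : vge x 0 -> vge (2 ^+ k * x) (k%:Z * e).
Proof. by move=> hx; rewrite mulrC; apply: vgeMl => //; apply: vge_pow2. Qed.

Lemma odd_val (w : int) : (2 * w + 1)%:~R != 0 :> L /\ v (2 * w + 1)%:~R = 0.
Proof.
rewrite -val1; apply: (@val_eq 1 _ e); rewrite ?oner_neq0 ?val1 //.
by rewrite intrD addrK intrM mulrC; apply: vgeMl; [apply: vge_int|right].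
Qed.

Lemma intr_neq0 (c : int) : c != 0 -> c%:~R != 0 :> L.
Proof.
move=> /int_pow2_odd[s [w ->]]; rewrite intrM rmorphXn /= mulf_neq0 //.
  by rewrite expf_neq0.
by have [] := odd_val w.
Qed.

Lemma natr_neq0 k : k.+1%:R != 0 :> L.
Proof. exact: (@intr_neq0 k.+1). Qed.

Lemma val_int (s : nat) (w : int) :
  v (2 ^+ s * (2 * w + 1))%:~R = s%:Z * e.
Proof.
have [o0 vo] := odd_val w.
by rewrite intrM rmorphXn /= valM ?expf_neq0 // vo valX // addr0.
Qed.

Lemma vge_intP (c : int) (k : nat) :
  vge c%:~R (k%:Z * e) -> (2 ^+ k %| c)%Z.
Proof.
have [-> //|c0] := eqVneq c 0.
have c0' := intr_neq0 c0; have [s [w cE]] := int_pow2_odd c0.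
rewrite vgeE // cE val_int => h; have ks : (k <= s)%N by nia.
by rewrite -(subnKC ks) exprD -mulrA dvdz_mulr.
Qed.

(* The copy of Q_2 inside [L]: the closure of [Z[1/2]]. *)
Definition Qbar : {pred L} := fun y =>
  `[< forall N, exists (c : int) (t : nat), vge (y - c%:~R / 2 ^+ t) N >].

Lemma Qbar_int (c : int) : c%:~R \in Qbar.
Proof. by apply/asboolP => N; exists c, 0; rewrite expr0 divr1 subrr; left. Qed.

Lemma Qbar_subring : subring_closed Qbar.
Proof.
have p2 t : (2 : L) ^+ t != 0 by rewrite expf_neq0.
split.
- exact: (Qbar_int 1).
- move=> x y /asboolP hx /asboolP hy; apply/asboolP => N.
  have [c [t h]] := hx N; have [c' [t' h']] := hy N.
  exists (c * 2 ^+ t' - c' * 2 ^+ t), (t + t')%N.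
  suff -> : (c * 2 ^+ t' - c' * 2 ^+ t)%:~R / 2 ^+ (t + t') =
    c%:~R / 2 ^+ t - c'%:~R / 2 ^+ t' :> L.
    by rewrite [X in vge X](_ : _ = x - c%:~R / 2 ^+ t - (y - c'%:~R / 2 ^+ t'));
      [apply: vgeB|ring].
  rewrite intrB !intrM !rmorphXn /= exprD; field; exact/andP.
- move=> x y /asboolP hx /asboolP hy; apply/asboolP => N.
  have [m hm] : exists m, vge x m /\ vge y m.
    exists (Num.min (v x) (v y)).
    by split; right; rewrite ge_min lexx ?orbT.
  set N' := `|N| + `|m|.
  have [c [t h]] := hx N'; have [c' [t' h']] := hy N'.
  exists (c * c'), (t + t')%N.
  suff -> : x * y - (c * c')%:~R / 2 ^+ (t + t') =
    (x - c%:~R / 2 ^+ t) * y + (y - c'%:~R / 2 ^+ t') * x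
      - (x - c%:~R / 2 ^+ t) * (y - c'%:~R / 2 ^+ t').
    apply: vgeB; first apply: vgeD.
    - by apply: vgeW (vgeM h hm.2); lia.
    - by apply: vgeW (vgeM h' hm.1); lia.
    - by apply: vgeW (vgeM h h'); lia.
  rewrite !intrM exprD; field; exact/andP.
Qed.

HB.instance Definition _ := GRing.isSubringClosed.Build L Qbar Qbar_subring.

Lemma Qbar_lim x : (forall N, exists2 y, y \in Qbar & vge (x - y) N) -> x \in Qbar.
Proof.
move=> h; apply/asboolP => N; have [y /asboolP/(_ N)[c [t hy]] xy] := h N.
by exists c, t; apply: vge_trans hy.
Qed.

Lemma Qbar_half : 2^-1 \in Qbar.
Proof. by apply/asboolP => N; exists 1, 1; rewrite div1r expr1 subrr; left. Qed.

(** The power of 2 is inverted by [Qbar_half]; the odd part has an integer inverse modulo [2 ^ |N|]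
    by Bezout, and that integer approximates the true inverse to precision [N]. *)
Lemma Qbar_intV (c : int) : c != 0 -> c%:~R^-1 \in Qbar.
Proof.
move=> /int_pow2_odd[s [w ->]].
rewrite intrM invfM rmorphXn /= -exprVn rpredM ?rpredX ?Qbar_half //.
have [o0 vo] := odd_val w.
apply: Qbar_lim => N.
have /coprimezP[[a b] /= ab] : coprimez (2 * w + 1) (2 ^+ `|N|%N).
  by rewrite coprimezXr //; apply/coprimezP; exists (1, - w) => /=; lia.
exists a%:~R; first exact: Qbar_int.
have abL : a%:~R * (2 * w + 1)%:~R + b%:~R * 2 ^+ `|N|%N = 1 :> L.
  by rewrite -[RHS]/(1%:~R) -[in RHS]ab [RHS]intrD (intrM _ a) (intrM _ b) rmorphXn.
have -> : (2 * w + 1)%:~R^-1 - a%:~R = 2 ^+ `|N|%N * (b%:~R / (2 * w + 1)%:~R) :> L.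
  apply: (mulIf o0); rewrite mulrBl mulVf // -[X in X - _]abL [X in X - _]addrC addrK.
  by rewrite -mulrA divfK // mulrC.
apply: vgeW (vge_pow2M _ _); first by nia.
apply: vgeMl; first exact: vge_int.
by right; rewrite valV // vo.
Qed.


Lemma val2z (z : int) : v (2 ^ z) = z * e.
Proof.
case: z => k; first by rewrite -exprnP valX.
by rewrite NegzE -exprnN valV ?expf_neq0 // valX // mulNr.
Qed.

(** The residue field of Q_2 has two elements, so the leading digit of a nonzero 2-adic number can
    only be 1. *)
Lemma Qbar_lead x : x \in Qbar -> x != 0 ->
  exists2 z : int, v x = z * e & vge (x - 2 ^ z) (v x + e).
Proof.
move=> /asboolP/(_ (v x + e))[c [t h]] x0.
have [||c0 vc] := @val_eq x (c%:~R / 2 ^+ t) (v x + e) x0; [lia|exact: vgeBC|].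
have {}c0 : c != 0 by apply: contraNneq c0 => ->; rewrite mul0r.
have [s [w cE]] := int_pow2_odd c0.
have [o0 vo] := odd_val w.
have p2 (z : int) : (2 : L) ^ z != 0 by rewrite expfz_neq0.
have {}cE : c%:~R / 2 ^+ t = (2 * w + 1)%:~R * 2 ^ (s%:Z - t%:Z) :> L.
  by rewrite cE intrM rmorphXn /= expfzDr // -exprnN -exprnP mulrA [_ * 2 ^+ s]mulrC.
exists (s%:Z - t%:Z); first by rewrite -vc cE valM // vo val2z add0r.
apply: (vge_trans h); rewrite cE -[X in _ - X]mul1r -mulrBl intrD addrK intrM.
rewrite -vc cE valM // vo add0r [_ + e]addrC -mulrA.
apply: vgeM; first by right.
by apply: vgeMl; [exact: vge_int|right].
Qed.

Lemma Qbar_val x : x \in Qbar -> x != 0 -> exists k : int, v x = k * e.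
Proof. by move=> hx x0; have [z] := Qbar_lead hx x0; exists z. Qed.

(** Valuations on [Qbar] are multiples of [e], so bounds round up. This makes good the loss of less
    than [e] incurred when a ramified generator is divided out. *)
Lemma Qbar_vge x N N' : x \in Qbar -> vge x N -> (N' - 1) * e < N -> vge x (N' * e).
Proof.
have [->|x0] := eqVneq x 0; first by left.
move=> hx; have [z] := Qbar_val hx x0; rewrite !vgeE // => -> le lt.
have := lt_le_trans lt le; rewrite ltr_pM2r // ler_pM2r //; lia.
Qed.

Lemma Qbar_mod x k : x \in Qbar -> vge x 0 ->
  exists c : int, vge (x - c%:~R) (k%:Z * e).
Proof.
move=> /asboolP/(_ (k%:Z * e))[c [t h]] x0.
have p2 : (2 : L) ^+ t != 0 by rewrite expf_neq0.
have /vge_intP/dvdzP[c' cE] : vge c%:~R (t%:Z * e).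
  have -> : c%:~R = (x - (x - c%:~R / 2 ^+ t)) * 2 ^+ t by field.
  rewrite -[_ * e]add0r; apply: vgeM (vge_pow2 _).
  by apply: vgeB => //; apply: vgeW h; nia.
by exists c'; move: h; rewrite cE intrM rmorphXn /= mulfK.
Qed.

Lemma vge_two x : vge x 0 -> vge (2 * x) e.
Proof. by move=> hx; rewrite mulrC; apply: vgeMl => //; right. Qed.

(* [2 w ^+ 2 + w = u] amounts to [(1 + 4 w) ^+ 2 = 1 + 8 u]. *)
Lemma hensel u : vge u 0 -> exists w,
  [/\ 2 * w ^+ 2 + w = u, vge w 0 &
   forall N, exists k, vge (iter k (fun x => u - 2 * x ^+ 2) u - w) N].
Proof.
(* Fixed-point iteration: [f x - f y = - 2 (x + y) (x - y)], so each step gains a factor 2. The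
   iterates appear in the conclusion because for an integer [u] they are integers, which places the
   limit in [Qbar]. *)
move=> hu; pose f x := u - 2 * x ^+ 2; pose a k := iter k f u.
have h2 x : vge x 0 -> vge (2 * x) 0 by apply: vgeMl; apply: (vge_int 2).
have a0 k : vge (a k) 0.
  by elim: k => //= k IH; apply: vgeB => //; apply/h2/vgeX.
have step k : vge (a k.+1 - a k) (k%:Z * e).
  elim: k => [|k IH]; first by rewrite mul0r; apply: vgeB.
  have -> : a k.+2 - a k.+1 = 2 * (- (a k.+1 + a k) * (a k.+1 - a k)).
    by rewrite /a /= -/(a k) /f; ring.
  have -> : k.+1%:Z * e = e + k%:Z * e by rewrite -add1n PoszD mulrDl mul1r.
  apply: vgeM; first by right.
  by apply: vgeMl => //; apply/vgeN/vgeD.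
have steps k j : vge (a (j + k)%N - a k) (k%:Z * e).
  elim: j => [|j IH]; first by rewrite subrr; left.
  by apply: vge_trans IH; apply: vgeW (step (j + k)%N); rewrite ler_pM2r //; lia.
have [|w hw] := v_complete (u := a).
  move=> N; exists `|N|%N => i j hi hj.
  apply: (@vgeW (`|N|%N%:Z * e)); first by nia.
  apply: (@vge_trans (a `|N|%N)); first by rewrite -(subnK hi).
  by apply: vgeBC; rewrite -(subnK hj).
have hw' N : exists k, (`|N| <= k)%N /\ forall i, (k <= i)%N -> vge (a i - w) N.
  have [k hk] := hw N; exists (maxn k `|N|)%N; rewrite leq_maxr; split=> // i.
  by rewrite geq_max => /andP[/hk].
have w0 : vge w 0.
  by have [k [_ /(_ _ (leqnn _)) hk]] := hw' 0; rewrite -[w](subKr (a k)); apply: vgeB.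
exists w; split=> // [|N]; last by have [k [_ hk]] := hw' N; exists k; apply: hk.
apply/subr0_eq/vge_small => N; have [k [_ hk]] := hw' N.
have -> : 2 * w ^+ 2 + w - u = (2 * (w + a k)) * (w - a k) + (w - a k.+1).
  by rewrite /a /= -/(a k) /f; ring.
apply: vgeD; last by apply/vgeBC/hk/leqW.
apply: vgeMl; first by apply/h2/vgeD.
exact/vgeBC/hk.
Qed.

Lemma sqrt_1_8 u : vge u 0 -> exists2 w, vge w 0 & (1 + 4 * w) ^+ 2 = 1 + 8 * u.
Proof. by move=> /hensel[w [<- w0 _]]; exists w => //; ring. Qed.

(** Two square roots in succession. The first root of [1 + 8 (2 u)] is [1 + 4 w] with
    [w = 2 (u - w ^+ 2)], hence equal to [1 + 8 (u - w ^+ 2)], which is again a square. *)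
Lemma fourth_root_1_16 u : vge u 0 -> exists w, w ^+ 4 = 1 + 16 * u.
Proof.
move=> hu; have [|w [wE w0 _]] := @hensel (2 * u).
  by apply: vgeMl => //; apply: (vge_int 2).
have [|w' _ w'E] := @sqrt_1_8 (u - w ^+ 2); first by apply/vgeB/vgeX.
exists (1 + 4 * w'); rewrite -[4%N]/(2 * 2)%N exprM w'E.
have -> : 1 + 8 * (u - w ^+ 2) = 1 + 4 * w.
  have -> : 1 + 8 * (u - w ^+ 2) = 1 + 4 * (2 * u) - 8 * w ^+ 2 by ring.
  by rewrite -wE; ring.
have -> : 1 + 16 * u = 1 + 8 * (2 * u) by ring.
by rewrite -wE; ring.
Qed.

Lemma fourth_root x y : x != 0 -> v x = 0 -> vge (y - x ^+ 4) (4 * e) ->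
  exists w, w ^+ 4 = y.
Proof.
move=> x0 vx h; have x40 : x ^+ 4 != 0 by rewrite expf_neq0.
have n16 : (16 : L) != 0 by apply: (@intr_neq0 16).
have v16 : v 16 = 4 * e by rewrite -(@valX 2 4 two_neq0); congr v; ring.
have [|w wE] := @fourth_root_1_16 ((y - x ^+ 4) / (16 * x ^+ 4)).
  apply: (@vgeW (4 * e + - (4 * e))); first by lia.
  apply: (vgeM h); right; rewrite valV ?mulf_neq0 // valM // valX // vx v16; lia.
by exists (x * w); rewrite exprMn wE; field; exact/andP.
Qed.

Lemma sqrt_int (a : int) : (a = 1 %[mod 8])%Z -> exists2 s, s \in Qbar & s ^+ 2 = a%:~R.
Proof.
move=> a8; have [w [wE w0 lim]] := hensel (vge_int (a %/ 8)%Z).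
exists (1 + 4 * w); last first.
  have aE : a = 1 + 8 * (a %/ 8)%Z by lia.
  have -> : a%:~R = 1 + 8 * (a %/ 8)%Z%:~R :> L by rewrite {1}aE intrD intrM.
  by rewrite -wE; ring.
rewrite rpredD ?rpred1 // rpredM ?(Qbar_int 4) //; apply: Qbar_lim => N.
have [k /vgeBC hk] := lim N; eexists; last exact: hk.
elim: k {hk} => [|k IH]; first exact: Qbar_int.
by rewrite rpredB ?Qbar_int // rpredM ?rpredX // (Qbar_int 2).
Qed.

(* [A / B] is a 2-adic square, as [w] is one. *)
Definition sqclass (A B : int) := exists t w : int,
  [/\ t != 0, B != 0, (w = 1 %[mod 8])%Z & A * B = t ^+ 2 * w].

Lemma sqclass_sqrt (A B : int) x : sqclass A B -> x ^+ 2 = A%:~R ->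
  exists q y, [/\ q \in Qbar, x = q * y & y ^+ 2 = B%:~R].
Proof.
move=> [t [w [t0 B0 w8 AB]]] xE; have [s sQ sE] := sqrt_int w8.
have t0' := intr_neq0 t0; have B0' := intr_neq0 B0.
have s0 : s != 0.
  have w0 : w != 0 by lia.
  by have := intr_neq0 w0; rewrite -sE sqrf_eq0.
exists (t%:~R * s / B%:~R), (x * B%:~R / (t%:~R * s)); split.
- by rewrite !rpredM ?Qbar_int ?Qbar_intV.
- by field; rewrite s0 t0'.
- have ABL : A%:~R * B%:~R = t%:~R ^+ 2 * s ^+ 2 :> L.
    by rewrite sE -rmorphXn /= -!intrM AB.
  rewrite !exprMn exprVn exprMn xE expr2 mulrA ABL; field; exact/andP.
Qed.

Lemma sqclass1_Qbar (A : int) x : sqclass A 1 -> x ^+ 2 = A%:~R -> x \in Qbar.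
Proof.
move=> /sqclass_sqrt h /h[q [y [qQ -> /eqP]]].
by rewrite sqrf_eq1 => /orP[] /eqP ->; rewrite rpredM ?rpredN ?rpred1.
Qed.

(** * Dense spans over Q_2 and fourth powers modulo 16 *)

Definition lin x1 x2 x3 y := exists q0 q1 q2 q3,
  [/\ q0 \in Qbar, q1 \in Qbar, q2 \in Qbar & q3 \in Qbar] /\
  y = q0 + q1 * x1 + q2 * x2 + q3 * x3.

(** Density only, without independence: smaller fields are described by zero generators, and
    [spanned 0 0 0] says that [L] is Q_2 itself. *)
Definition spanned x1 x2 x3 := forall y N, exists2 z, lin x1 x2 x3 z & vge (y - z) N.

Lemma spanned_change x1 x2 x3 y1 y2 y3 :
  lin y1 y2 y3 x1 -> lin y1 y2 y3 x2 -> lin y1 y2 y3 x3 ->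
  spanned x1 x2 x3 -> spanned y1 y2 y3.
Proof.
move=> [a0 [a1 [a2 [a3 [[? ? ? ?] ->]]]]] [b0 [b1 [b2 [b3 [[? ? ? ?] ->]]]]].
move=> [c0 [c1 [c2 [c3 [[? ? ? ?] ->]]]]] sp y N.
have [_ [q0 [q1 [q2 [q3 [[? ? ? ?] ->]]]]] h] := sp y N.
eexists; last exact: h.
exists (q0 + q1 * a0 + q2 * b0 + q3 * c0), (q1 * a1 + q2 * b1 + q3 * c1),
  (q1 * a2 + q2 * b2 + q3 * c2), (q1 * a3 + q2 * b3 + q3 * c3).
by split; [split; rewrite !rpredD // rpredM|ring].
Qed.

Ltac vge_integral := repeat first
  [ assumption | exact: vge_nat | exact: (vge_int 1) | exact: vge_int
  | apply: vgeD | apply: vgeN | apply: vgeO | apply: vgeX ].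

Definition coords_val x y (t : coords) : L :=
  t.1.1%:~R + t.1.2%:~R * x + t.2.1%:~R * y + t.2.2%:~R * (x * y).

Lemma coords_valD x y t t' :
  coords_val x y (t + t') = coords_val x y t + coords_val x y t'.
Proof.
by case: t t' => [[a b] [c d]] [[a' b'] [c' d']]; rewrite /coords_val /= !intrD; ring.
Qed.

Lemma coords_val_mod16 x y t : vge x 0 -> vge y 0 ->
  vge (coords_val x y t - coords_val x y (coords_mod16 t)) (4 * e).
Proof.
move=> hx hy; case: t => [[a b] [c d]]; rewrite /coords_val /coords_mod16 /=.
have E (n : int) : n%:~R = 2 ^+ 4 * (n %/ 16)%Z%:~R + (n %% 16)%Z%:~R :> L.
  rewrite {1}(divz_eq n 16) intrD intrM; ring.
rewrite [a%:~R]E [b%:~R]E [c%:~R]E [d%:~R]E.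
set r := (X in vge X); have -> : r = 2 ^+ 4 * ((a %/ 16)%Z%:~R + (b %/ 16)%Z%:~R * x
   + (c %/ 16)%Z%:~R * y + (d %/ 16)%Z%:~R * (x * y)) by rewrite /r; ring.
by apply: (vge_pow2M 4); vge_integral.
Qed.

Lemma coords_val_sqr (A B0 B1 : int) x y t :
  x ^+ 2 = A%:~R -> y ^+ 2 = B0%:~R + B1%:~R * x ->
  coords_val x y t ^+ 2 = coords_val x y (coords_sqr A B0 B1 t).
Proof.
move=> xE yE; case: t => [[a b] [c d]]; rewrite /coords_val /= !intrD !intrM -xE.
have -> : (a%:~R + b%:~R * x + c%:~R * y + d%:~R * (x * y)) ^+ 2 =
  (a%:~R + b%:~R * x) ^+ 2 + (c%:~R + d%:~R * x) ^+ 2 * y ^+ 2 +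
  2 * (a%:~R + b%:~R * x) * (c%:~R + d%:~R * x) * y by ring.
rewrite yE; have x3 : x ^+ 3 = A%:~R * x by rewrite -xE exprSr.
ring: xE x3.
Qed.

Lemma vge_sqr_sub x y N : vge x 0 -> vge y 0 -> vge (x - y) N ->
  vge (x ^+ 2 - y ^+ 2) N.
Proof. by move=> hx hy h; rewrite subr_sqr mulrC; apply: vgeMl => //; apply: vgeD. Qed.

(** With [h = x - y], the difference is [h (h (h ^+ 2 + 4 y h + 6 y ^+ 2) + 4 y ^+ 3)], and 4
    divides both factors. *)
Lemma vge_fourth_sub x y : vge x 0 -> vge y 0 -> vge (x - y) (2 * e) ->
  vge (x ^+ 4 - y ^+ 4) (4 * e).
Proof.
move=> hx hy h.
have -> : x ^+ 4 - y ^+ 4 = (x - y) * ((x - y) *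
    ((x - y) ^+ 2 + 2 * (2 * (y * (x - y))) + 6 * y ^+ 2) + 2 ^+ 2 * (y ^+ 3)) by ring.
have -> : 4 * e = 2 * e + 2 * e by lia.
have hxy := vgeB hx hy.
apply: (vgeM h); apply: vgeD; last by apply: (vge_pow2M 2); apply: vgeX.
rewrite mulrC; apply: vgeMl => //; vge_integral.
Qed.

Section FourthSums.
Variables (A B0 B1 : int) (x y : L) (bx bz : bool).
Hypothesis xE : x ^+ 2 = A%:~R.
Hypothesis yE : y ^+ 2 = B0%:~R + B1%:~R * x.

Lemma gen_integral : vge x 0 /\ vge y 0.
Proof.
have hx : vge x 0 by apply: vge_sqr; rewrite mulr0 xE; apply: vge_int.
split=> //; apply: vge_sqr; rewrite mulr0 yE; apply: vgeD; first exact: vge_int.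
by apply: vgeO => //; apply: vge_int.
Qed.

Lemma coords_val_integral t : vge (coords_val x y t) 0.
Proof.
by have [hx hy] := gen_integral; rewrite /coords_val; vge_integral.
Qed.

Lemma coords_val_pow4 t :
  vge (coords_val x y t ^+ 4 - coords_val x y (coords_pow4 A B0 B1 t)) (4 * e).
Proof.
have [hx hy] := gen_integral; have I := coords_val_integral.
set s := coords_mod16 (coords_sqr A B0 B1 t).
apply: (@vge_trans (coords_val x y s ^+ 2)).
  rewrite [X in X - _](_ : _ = (coords_val x y t ^+ 2) ^+ 2); last by rewrite -exprM.
  apply: vge_sqr_sub => //; first exact: vgeX.
  by rewrite (coords_val_sqr _ xE yE); apply: coords_val_mod16.
by rewrite (coords_val_sqr _ xE yE); apply: coords_val_mod16.
Qed.

Hypothesis integral_mod4 : forall z, vge z 0 ->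
  exists2 t, t \in box bx bz & vge (z - coords_val x y t) (2 * e).
Hypothesis null_mod16 : forall t,
  vge (coords_val x y t) (4 * e) -> coords_null bx bz t.

(** Each induction step replaces one summand by its representative in the box, which changes the
    total by a multiple of 16 only, and moves its fourth power into the accumulator [t]. *)
Lemma integral_fourth_sum g (z : 'I_g -> L) t : (forall i, vge (z i) 0) ->
  no_null_sum (undup (map (coords_pow4 A B0 B1) (box bx bz))) (coords_null bx bz) g t ->
  ~ vge (coords_val x y t + \sum_(i < g) z i ^+ 4) (4 * e).
Proof.
elim: g z t => [|g IH] z t hz /=.
  by rewrite big_ord0 addr0 => /negP nt /null_mod16.
move=> /allP all0 h; have [s sb zs] := integral_mod4 (hz ord0).
have {}all0 := all0 (coords_pow4 A B0 B1 s); rewrite mem_undup map_f // in all0.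
have {IH all0} := IH (fun i => z (lift ord0 i)) _ _ (all0 isT); apply=> //.
move: h; rewrite big_ord_recl coords_valD => h.
set S := \sum_(i < g) _ in h *.
rewrite [X in vge X](_ : _ = (coords_val x y t + (z ord0 ^+ 4 + S)) -
  (z ord0 ^+ 4 - coords_val x y s ^+ 4) -
  (coords_val x y s ^+ 4 - coords_val x y (coords_pow4 A B0 B1 s))); last by ring.
apply: vgeB (coords_val_pow4 s); apply: vgeB h _.
exact: vge_fourth_sub (coords_val_integral s) zs.
Qed.
End FourthSums.

Lemma fourth_sum_integral g : fourth_sum L g ->
  exists z : 'I_g -> L, (forall i, vge (z i) 0) /\ \sum_(i < g) z i ^+ 4 = -1.
Proof.
move=> [z zE].
have [all0|/existsNP[i0 /not_orP[/eqP zi0 vi0]]] := pselect (forall i, vge (z i) 0).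
  by exists z.
(* The minimum runs over nonzero entries only, since [v 0] carries no information. *)
case: (@Order.TotalTheory.arg_minP _ _ _ i0 (fun i => z i != 0) (fun i => v (z i)) zi0).
move=> j zj0 jmin; have vj : v (z j) < 0 by have := jmin _ zi0; lia.
exists (fun i => if i == j then (z j)^-1 else z i / z j); split => [i|].
  case: eqP => [_|_]; first by right; rewrite valV //; lia.
  have [->|zi] := eqVneq (z i) 0; first by rewrite mul0r; left.
  by right; rewrite valM ?invr_neq0 // valV //; have := jmin _ zi; lia.
have zj40 : z j ^+ 4 != 0 by rewrite expf_neq0.
apply: (mulIf zj40); rewrite mulN1r mulr_suml.
have := zE; rewrite (bigD1 j) //= => /(canRL (addKr _)) E.
rewrite (bigD1 j) //= eqxx -exprMn mulVf // expr1n.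
under eq_bigr => i /negPf ij do rewrite ij -exprMn divfK //.
by rewrite E addrCA subrr addr0.
Qed.

Section Spans.
Variables (x y : L) (bx bz : bool).

(* The [q_i] are integral coordinates: multiples of [2 ^ n] are detected
   coordinatewise.  A generator set to 0 has its flag [bx] or [bz] off. *)
Definition splits := forall q0 q1 q2 q3 (n : int),
  q0 \in Qbar -> q1 \in Qbar -> q2 \in Qbar -> q3 \in Qbar ->
  vge (q0 + q1 * x + q2 * y + q3 * (x * y)) (n * e) ->
  [/\ vge q0 (n * e), bx -> vge q1 (n * e)
    & bz -> vge q2 (n * e) /\ vge q3 (n * e)].

Lemma Qbar_digit (b : bool) q z : q \in Qbar -> vge z 0 ->
  (~~ b -> z = 0) -> (b -> vge q 0) ->
  exists2 c : int, c \in digits b & vge (q * z - c%:~R * z) (2 * e).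
Proof.
case: b => qQ hz; last first.
  by move=> /(_ isT) -> _; exists 0; rewrite ?inE // !mulr0 subrr; left.
move=> _ hq; have [c hc] := Qbar_mod 2 qQ (hq isT).
exists (c %% 4)%Z; first by rewrite !inE; lia.
rewrite -mulrBl mulrC; apply: vgeMl => //; apply: (vge_trans hc).
have -> : c%:~R - (c %% 4)%Z%:~R = 2 ^+ 2 * (c %/ 4)%Z%:~R :> L.
  by rewrite {1}(divz_eq c 4) intrD intrM; ring.
by apply: (vge_pow2M 2); apply: vge_int.
Qed.

(** [splits] is used twice: with [n = 0] it makes the coordinates of an integral element 2-adic
    integers, so that the element reduces into the box modulo 4; with [n = 4] it turns vanishing
    modulo 16 into the coordinatewise test of the enumeration. *)
Lemma spanned_no_fourth_sum (A B0 B1 : int) g :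
  x ^+ 2 = A%:~R -> y ^+ 2 = B0%:~R + B1%:~R * x ->
  (~~ bx -> x = 0) -> (~~ bz -> y = 0) ->
  spanned x y (x * y) -> splits -> no_fourth_sum_mod16 A B0 B1 bx bz g ->
  ~ fourth_sum L g.
Proof.
move=> xE yE x0 y0 sp spl chk /fourth_sum_integral[z [hz zE]].
have [hx hy] := gen_integral xE yE.
apply: (integral_fourth_sum xE yE _ _ hz chk) => [w hw|t ht|]; last first.
- by rewrite zE /coords_val /= !mul0r !addr0 subrr; left.
- case: t ht => [[a b] [c d]]; rewrite /coords_val /= => ht.
  have [ha hb hcd] := spl _ _ _ _ 4 (Qbar_int a) (Qbar_int b) (Qbar_int c) (Qbar_int d) ht.
  have D (n : int) : vge n%:~R (4 * e) -> (n %% 16)%Z == 0.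
    by move=> /(@vge_intP n 4); rewrite -/(2 ^+ 4); lia.
  apply/and3P; split; [exact: D|apply/implyP => /hb; exact: D|].
  by apply/implyP => /hcd[/D -> /D ->].
have [_ [q0 [q1 [q2 [q3 [[Q0 Q1 Q2 Q3] ->]]]]] h] := sp w (2 * e).
have [|h0 h1 h23] := spl _ _ _ _ 0 Q0 Q1 Q2 Q3.
  rewrite mul0r -[X in vge X](subKr w); apply: vgeB => //; apply: vgeW h; lia.
rewrite mul0r in h0 h1 h23.
have hxy := vgeO hx hy.
have [|c0 d0 k0] := Qbar_digit Q0 (vge_int 1) _ (fun _ : true => h0); first by [].
have [c1 d1 k1] := Qbar_digit Q1 hx x0 h1.
have [c2 d2 k2] := Qbar_digit Q2 hy y0 (fun b => (h23 b).1).
have [|c3 d3 k3] := Qbar_digit Q3 hxy _ (fun b => (h23 b).2).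
  by move=> /y0 ->; rewrite mulr0.
exists ((c0, c1), (c2, c3)); first by
  apply/allpairsP; exists ((c0, c1), (c2, c3)); split=> //; apply/allpairsP;
    [exists (c0, c1)|exists (c2, c3)].
apply: (vge_trans h); rewrite /coords_val /=.
rewrite [X in vge X](_ : _ = (q0 * 1%:~R - c0%:~R * 1%:~R) + (q1 * x - c1%:~R * x) +
   (q2 * y - c2%:~R * y) + (q3 * (x * y) - c3%:~R * (x * y))); last by ring.
by rewrite -!/(2 * e); do 3 (apply: vgeD => //).
Qed.
End Spans.

Lemma mul_e_inj (j k : int) : j * e = k * e -> j = k.
Proof. by apply: mulIf; lia. Qed.

(* [x] has half the valuation of 2, resp. a quarter of it; the condition
   [x != 0] matters because [v 0] is arbitrary. *)
Definition half2 x := x != 0 /\ 2 * v x = e.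
Definition quarter2 x := x != 0 /\ 4 * v x = e.

(** The valuation of [q0] is an even multiple of [e / 2] and that of [q1 x] an odd one. *)
Lemma ram2_split q0 q1 x N : q0 \in Qbar -> q1 \in Qbar -> half2 x ->
  vge (q0 + q1 * x) N -> vge q0 N /\ vge (q1 * x) N.
Proof.
move=> Q0 Q1 [x0 vx].
apply: vge_split => q00; rewrite mulf_eq0 negb_or => /andP[q10 _].
have [j jE] := Qbar_val Q0 q00; have [k kE] := Qbar_val Q1 q10.
rewrite valM // jE kE => E; have /mul_e_inj : (2 * j) * e = (2 * k + 1) * e by lia.
lia.
Qed.

Lemma valD_neq x y : x != 0 -> y != 0 -> v x <> v y ->
  v (x + y) = v x \/ v (x + y) = v y.
Proof.
move=> x0 y0 ne; have [lt|le] := ltP (v x) (v y).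
  by left; have [] := vgeDN0 x0 lt (or_intror (lexx _)).
right; have lt : v y < v x by lia.
by rewrite addrC; have [] := vgeDN0 y0 lt (or_intror (lexx _)).
Qed.

Lemma ram2_val q0 q1 x : q0 \in Qbar -> q1 \in Qbar -> half2 x ->
  q0 + q1 * x != 0 -> exists k : int, 2 * v (q0 + q1 * x) = k * e.
Proof.
move=> Q0 Q1 [x0 vx].
have [->|q00] := eqVneq q0 0.
  rewrite add0r mulf_eq0 negb_or => /andP[q10 _].
  have [k kE] := Qbar_val Q1 q10; exists (2 * k + 1); rewrite valM // kE; lia.
have [j jE] := Qbar_val Q0 q00.
have [->|q10] := eqVneq q1 0.
  by rewrite mul0r addr0 => _; exists (2 * j); rewrite jE; lia.
have [k kE] := Qbar_val Q1 q10 => _.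
have [||->|->] := @valD_neq q0 (q1 * x) q00.
- by rewrite mulf_neq0.
- rewrite valM // jE kE => E; have /mul_e_inj : (2 * j) * e = (2 * k + 1) * e by lia.
  lia.
- by exists (2 * j); rewrite jE; lia.
- by exists (2 * k + 1); rewrite valM // kE; lia.
Qed.

Lemma vge_divr x y N : y != 0 -> vge (x * y) N -> vge x (N - v y).
Proof.
have [->|x0] := eqVneq x 0; first by left.
by move=> y0; rewrite !vgeE ?mulf_neq0 // valM //; lia.
Qed.

Lemma ram2_Qbar_vge q x (n : int) : q \in Qbar -> half2 x ->
  vge (q * x) (n * e) -> vge q (n * e).
Proof.
by move=> Qq [x0 vx] /(vge_divr x0) h; apply: (Qbar_vge Qq h); lia.
Qed.

Lemma splits_Q2 : splits 0 0 false false.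
Proof. by move=> q0 q1 q2 q3 n _ _ _ _; rewrite !mulr0 !addr0; split. Qed.

Lemma splits_ram2 x : half2 x -> splits x 0 true false.
Proof.
move=> hx q0 q1 q2 q3 n Q0 Q1 _ _; rewrite !mulr0 !addr0.
by move=> /(ram2_split Q0 Q1 hx)[h0 /(ram2_Qbar_vge Q1 hx) h1].
Qed.

(** For an odd radicand [x] is a unit; the unimodular change to the basis [1, 1 + x] restores
    distinct valuations. *)
Lemma splits_ram2_shift x : half2 (1 + x) -> splits x 0 true false.
Proof.
move=> hx q0 q1 q2 q3 n Q0 Q1 _ _; rewrite !mulr0 !addr0.
have -> : q0 + q1 * x = (q0 - q1) + q1 * (1 + x) by ring.
move=> /(ram2_split (rpredB Q0 Q1) Q1 hx)[h0 /(ram2_Qbar_vge Q1 hx) h1].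
by split=> //; rewrite -(subrK q1 q0); apply: vgeD.
Qed.

Lemma quarter_neq (a b c j k : int) :
  2 * a = j * e -> 2 * b = k * e -> 4 * c = e -> a = b + c -> False.
Proof.
move=> jE kE cE E; have /mul_e_inj : (2 * j) * e = (2 * k + 1) * e by lia.
lia.
Qed.

(* The valuations of [1], [1 + x], [y - 1] and [(1 + x) (y - 1)] are
   [0, 1/2, 1/4, 3/4] of that of 2: distinct modulo the value group of Q_2. *)
Lemma splits_ram4 x y : half2 (1 + x) -> quarter2 (y - 1) -> splits x y true true.
Proof.
move=> hx [y0 vy] q0 q1 q2 q3 n Q0 Q1 Q2 Q3.
have Q23 := rpredB Q2 Q3; have Q13 := rpredD Q1 Q3.
have Q0123 := rpredB (rpredD Q0 Q2) Q13.
have -> : q0 + q1 * x + q2 * y + q3 * (x * y) =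
  ((q0 + q2 - (q1 + q3)) + (q1 + q3) * (1 + x)) +
  ((q2 - q3) + q3 * (1 + x)) * (y - 1) by ring.
move=> H; have [|h h'] := vge_split _ H.
  move=> a0; rewrite mulf_eq0 negb_or => /andP[b0 _].
  have [j jE] := ram2_val Q0123 Q13 hx a0; have [k kE] := ram2_val Q23 Q3 hx b0.
  rewrite valM // => E; exact: (quarter_neq jE kE vy E).
have [h0123 /(ram2_Qbar_vge Q13 hx) h13] := ram2_split Q0123 Q13 hx h.
have [h23 /(vge_divr hx.1) h3] := ram2_split Q23 Q3 hx (vge_divr y0 h').
have vx := hx.2.
(* Division by [y - 1] costs [e / 4], and by [1 + x] a further [e / 2]; both totals are below [e],
   so rounding in [Qbar] recovers them. *)
have {}h23 : vge (q2 - q3) (n * e).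
  by apply: (Qbar_vge Q23 h23); clear - vy v2_gt0; lia.
have {}h3 : vge q3 (n * e).
  by apply: (Qbar_vge Q3 h3); clear - vx vy v2_gt0; lia.
have h2 : vge q2 (n * e) by rewrite -(subrK q3 q2); apply: vgeD.
have h1 : vge q1 (n * e) by rewrite -(addrK q3 q1); apply: vgeB.
split=> //; have -> : q0 = (q0 + q2 - (q1 + q3)) - q2 + (q1 + q3) by ring.
by apply: vgeD => //; apply: vgeB.
Qed.

(** * Fourth levels of the extensions of Q_2 *)

Definition vunit x := x != 0 /\ v x = 0.

Lemma vunit_odd (c : int) : (c %% 2)%Z = 1 -> vunit c%:~R.
Proof. by move=> c1; have := odd_val (c %/ 2)%Z; have <- : c = 2 * (c %/ 2)%Z + 1 by lia. Qed.

Lemma vunitM x y : vunit x -> vunit y -> vunit (x * y).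
Proof. by move=> [x0 vx] [y0 vy]; rewrite /vunit mulf_neq0 // valM // vx vy. Qed.

Lemma vunitN x : vunit x -> vunit (- x).
Proof. by rewrite /vunit oppr_eq0 valN. Qed.

Lemma vunitD x y : vunit x -> vge y e -> vunit (x + y).
Proof. by move=> [x0 vx] hy; rewrite /vunit -vx; apply: vgeDN0 hy => //; rewrite vx. Qed.

Lemma vunitDr x y : vge x e -> vunit y -> vunit (x + y).
Proof. by move=> *; rewrite addrC; apply: vunitD. Qed.

Lemma vunit_sqrt x y : vunit y -> x ^+ 2 = y -> vunit x.
Proof.
move=> [y0 vy] xE; have x0 : x != 0 by rewrite -sqrf_eq0 xE.
by split=> //; move: vy; rewrite -xE valX //; lia.
Qed.

Lemma half2_sqr x w : vunit w -> x ^+ 2 = 2 * w -> half2 x.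
Proof.
move=> [w0 vw] xE; have x0 : x != 0 by rewrite -sqrf_eq0 xE mulf_neq0.
by split=> //; have := valX 2 x0; rewrite xE valM // vw; lia.
Qed.

Lemma half2_even (r : int) x : (r %% 2)%Z = 1 -> x ^+ 2 = (2 * r)%:~R -> half2 x.
Proof. by rewrite intrM => r1; apply: half2_sqr; apply: vunit_odd. Qed.

Lemma half2_odd (A : int) x : (A = 3 %[mod 4])%Z -> x ^+ 2 = A%:~R -> half2 (1 + x).
Proof.
move=> A3 xE; pose h := ((A + 1) %/ 4)%Z.
have AE : A = 4 * h - 1 by rewrite /h; lia.
apply: (@half2_sqr _ (x + 2 * h%:~R)).
  apply: vunitD; last by apply: vge_two; apply: vge_int.
  by apply: vunit_sqrt xE; apply: vunit_odd; lia.
have -> : (1 + x) ^+ 2 = 1 + 2 * x + x ^+ 2 by ring.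
by rewrite xE AE intrB intrM; ring.
Qed.

(** The factors [y - 1] and [y + 1] differ by 2. If [v (y - 1) < e] they have equal valuation, half
    of [e / 2]; otherwise their product would have valuation at least [2 e]. *)
Lemma quarter2_sqr y : half2 (y ^+ 2 - 1) -> quarter2 (y - 1).
Proof.
have -> : y ^+ 2 - 1 = (y - 1) * (y + 1) by ring.
move=> [] /[dup] yy0; rewrite mulf_eq0 negb_or => /andP[y0 y0'].
rewrite valM // => vy; split=> //.
have E : y + 1 = y - 1 + 2 by ring.
have [lt|le] := ltP (v (y - 1)) e.
  have [_ ] := vgeDN0 y0 lt (or_intror (lexx _) : vge 2 e); rewrite -E; lia.
have : vge (y + 1) e by rewrite E; apply: vgeD; right.
by rewrite vgeE //; lia.
Qed.

(** The unit term [x] alone absorbs the error modulo 16; the terms in [s] are kept unchanged. *)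
Lemma fourth_sum_hensel x (s : seq L) : vunit x ->
  vge (-1 - \sum_(z <- s) z ^+ 4 - x ^+ 4) (4 * e) -> fourth_sum L (size s).+1.
Proof.
move=> [x0 vx] /(fourth_root x0 vx)[w wE].
by apply: (@fourth_sum_seq _ (w :: s)); rewrite big_cons wE subrK.
Qed.

Lemma vunit1 : vunit 1. Proof. exact: (@vunit_odd 1). Qed.

Lemma level_Q2 : spanned 0 0 0 -> fourth_level L = Some 15%N.
Proof.
move=> sp; apply: fourth_level_eq.
  apply: (@fourth_sum_hensel 1 (nseq 14 1) vunit1); rewrite /= !big_cons big_nil.
  rewrite [X in vge X](_ : _ = 2 ^+ 4 * -1); last by ring.
  by apply: (vge_pow2M 4); vge_integral.
apply: (spanned_no_fourth_sum _ _ _ _ _ splits_Q2 Q2_check);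
  by rewrite ?expr0n ?mulr0 ?addr0.
Qed.

Lemma level_sqrt_odd (A : int) x : A \in [:: -1; 3] -> x ^+ 2 = A%:~R ->
  spanned x 0 0 -> fourth_level L = Some 4%N.
Proof.
move=> A13 xE sp; have hx : half2 (1 + x).
  by apply: half2_odd xE; move: A13; rewrite !inE => /orP[]/eqP ->.
have [ix _] : vge x 0 /\ vge 0 0 by apply: (@gen_integral A 0 0) => //; ring.
apply: fourth_level_eq.
  (* [(1 + x) ^+ 4] is -4 for [A = -1] and [28 + 16 x] for [A = 3], so it is -4 modulo 16 in both
     cases, and -4 + 3 = -1. *)
  apply: (@fourth_sum_hensel 1 [:: 1 + x; 1; 1] vunit1); rewrite !big_cons big_nil.
  have x4 : (1 + x) ^+ 4 = (1 + x ^+ 2) ^+ 2 + 4 * (1 + x ^+ 2) * x + 4 * x ^+ 2 by ring.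
  move: A13 xE; rewrite !inE x4 => /orP[]/eqP -> ->.
    by rewrite [X in vge X](_ : _ = 0); [left|ring].
  rewrite [X in vge X](_ : _ = 2 ^+ 4 * (-2 - x)); last by ring.
  by apply: (vge_pow2M 4); vge_integral.
apply: (@spanned_no_fourth_sum x 0 true false A 0 0); rewrite ?expr0n ?mul0r ?mulr0 ?addr0 //.
- exact: splits_ram2_shift.
- move: A13; rewrite !inE => /orP[]/eqP ->; [exact: Q2_sqrtN1_check|exact: Q2_sqrt3_check].
Qed.

Lemma level_sqrt_even (A : int) x : A \in [:: 2; -2; 6; -6] -> x ^+ 2 = A%:~R ->
  spanned x 0 0 -> fourth_level L = Some 6%N.
Proof.
move=> A26 xE sp; apply: fourth_level_eq.
  (* [x ^+ 4] is 4 or 36, so 4 modulo 16, and 3 * 4 + 3 = 15. The quotients 1 and 7 below come from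
     16 and 112. *)
  apply: (@fourth_sum_hensel 1 [:: x; x; x; 1; 1] vunit1); rewrite !big_cons big_nil.
  have -> : x ^+ 4 = (x ^+ 2) ^+ 2 by ring.
  rewrite xE [X in vge X](_ : _ = 2 ^+ 4 * (- if `|A|%N == 2 then 1 else 7)).
    by apply: (vge_pow2M 4); case: eqP => _; vge_integral.
  by move: A26; rewrite !inE => /or4P[]/eqP -> /=; ring.
apply: (@spanned_no_fourth_sum x 0 true false A 0 0); rewrite ?expr0n ?mul0r ?mulr0 ?addr0 //.
- apply: splits_ram2; apply: (@half2_even (A %/ 2)%Z).
    by move: A26; rewrite !inE => /or4P[]/eqP ->.
  by rewrite xE; move: A26; rewrite !inE => /or4P[]/eqP ->.
- exact: Q2_sqrt_even_check.
Qed.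

Lemma no_fourth_root_N1 :
  (forall z, z != 0 -> exists k : int, 2 * v z = k * e) -> ~ fourth_sum L 1.
Proof.
move=> half [x]; rewrite big_ord1; move: (x ord0) => {}x xE.
have ux : vunit x.
  have x20 : vunit (x ^+ 2).
    by apply: (@vunit_sqrt _ (-1)); [apply/vunitN/vunit1|rewrite -xE; ring].
  exact: vunit_sqrt x20 _.
have uz : vunit (x * (3 * x + 2 * (- x ^+ 2 - 1))).
  apply: (vunitM ux); apply: vunitD.
    by apply: vunitM => //; apply: (@vunit_odd 3).
  have ix : vge x 0 by right; rewrite ux.2.
  by apply: vge_two; vge_integral.
(* Once [x ^+ 4 = -1] cancels the constant term, exactly one factor 2 splits off and the cofactor is
   a unit. *)
have zE : (x - 1) ^+ 4 = 2 * (x * (3 * x + 2 * (- x ^+ 2 - 1))).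
  have -> : (x - 1) ^+ 4 = x ^+ 4 - 4 * x ^+ 3 + 6 * x ^+ 2 - 4 * x + 1 by ring.
  by rewrite xE; ring.
have z0 : x - 1 != 0.
  have : (x - 1) ^+ 4 != 0 by rewrite zE mulf_neq0 //; case: uz.
  by rewrite expf_eq0.
have := valX 4 z0; rewrite zE valM //; last by case: uz.
rewrite uz.2 addr0; have [k kE] := half _ z0 => vE.
have /mul_e_inj : 1 * e = (2 * k) * e by lia.
lia.
Qed.

(** Q_2(sqrt(-3)) is unramified. In the basis [1, w] with [w] a cube root of unity, [w (1 + w) = -1]
    makes [w] and [1 + w] units, so only coordinates of equal valuation could cancel. *)
Lemma eta_val x q0 q1 : x ^+ 2 = - 3 -> q0 \in Qbar -> q1 \in Qbar ->
  q0 + q1 * x != 0 -> exists k : int, v (q0 + q1 * x) = k * e.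
Proof.
move=> xE Q0 Q1; pose w := (-1 + x) / 2; pose r := 2 * q1.
have -> : q0 + q1 * x = (q0 + q1) + r * w by rewrite /r /w; field.
have wE : w * (1 + w) = -1.
  have -> : w * (1 + w) = (x ^+ 2 - 1) / 4 by rewrite /w; field; rewrite !natr_neq0.
  by rewrite xE; field; rewrite !natr_neq0.
have Qr : r \in Qbar by rewrite rpredM // (Qbar_int 2).
have Q01 := rpredD Q0 Q1; move: (q0 + q1) Q01 => s Qs.
have uw : vunit w /\ vunit (1 + w).
  have : w * (1 + w) != 0 by rewrite wE oppr_eq0 oner_eq0.
  rewrite mulf_eq0 negb_or => /andP[w0 w10].
  have vw : v w + v (1 + w) = 0 by rewrite -valM // wE valN val1.
  have [neg|nneg] := ltP (v w) 0.
    have [_] := @vgeDN0 w 1 0 w0 neg (vge_int 1); rewrite addrC => v1w.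
    by move: vw neg; rewrite v1w; move: (v w) => a; clear; lia.
  have [pos|npos] := ltP 0 (v w); last first.
    have vw0 : v w = 0 by apply/le_anti/andP.
    by split; split=> //; rewrite -vw vw0 add0r.
  have v1w : v 1 < v w by rewrite val1.
  have [_] := vgeDN0 (oner_neq0 L) v1w (or_intror (lexx _)).
  rewrite val1 => {}v1w; by move: vw pos; rewrite v1w addr0 => ->.
have [->|r0] := eqVneq r 0; first by rewrite mul0r addr0; apply: Qbar_val.
have [->|s0] := eqVneq s 0.
  by rewrite add0r => _; rewrite valM ?uw.1.1 // uw.1.2 addr0; apply: Qbar_val.
have [j jE hj] := Qbar_lead Qs s0; have [k kE hk] := Qbar_lead Qr r0.
have [jk|njk] := eqVneq j k; last first.
  have [||->|->] := @valD_neq s (r * w) s0.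
  - by rewrite mulf_neq0 ?uw.1.1.
  - by rewrite valM ?uw.1.1 // uw.1.2 addr0 jE kE => /mul_e_inj /eqP; rewrite (negPf njk).
  - by exists j.
  - by exists k; rewrite valM ?uw.1.1 // uw.1.2 addr0.
(* Here [s] and [r] have the same leading term [2 ^ k], so [s - r] has larger valuation than [r] and
   the unit [1 + w] decides. *)
have -> : s + r * w = r * (1 + w) + (s - r) by ring.
exists k; rewrite -kE -[v r]addr0 -uw.2.2 -valM ?uw.2.1 //.
have [|||_ ->//] := @vgeDN0 (r * (1 + w)) (s - r) (v r + e).
- by rewrite mulf_neq0 ?uw.2.1.
- by rewrite valM ?uw.2.1 // uw.2.2; lia.
apply: (@vge_trans (2 ^ k)); last exact: vgeBC.
by rewrite -jk kE -jk -jE.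
Qed.

(** For the lower bound, elements of Q_2(sqrt(-3)) have valuations in [e Z] and their multiples by
    [y] in [e / 2 + e Z], so the two parts cannot cancel; [y = 0] is the unramified field. *)
Lemma level_sqrtN3 x y : x ^+ 2 = - 3 -> y = 0 \/ half2 y ->
  spanned x y (x * y) -> fourth_level L = Some 2%N.
Proof.
move=> xE hy sp; apply: fourth_level_eq.
  apply: (@fourth_sum_seq _ [:: (-1 + x) / 2; (-1 - x) / 2]).
  rewrite !big_cons big_nil.
  have -> : ((-1 + x) / 2) ^+ 4 + (((-1 - x) / 2) ^+ 4 + 0) =
     (1 + 6 * x ^+ 2 + (x ^+ 2) ^+ 2) / 8 by field; rewrite !natr_neq0.
  by rewrite xE; field; rewrite !natr_neq0.
apply: no_fourth_root_N1 => z z0.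
have [_ [q0 [q1 [q2 [q3 [[Q0 Q1 Q2 Q3] ->]]]]] h] := sp z (v z + 1).
have vz : v z < v z + 1 by lia.
have [w0 <-] := val_eq z0 vz (vgeBC h).
move: w0; have -> : q0 + q1 * x + q2 * y + q3 * (x * y) =
  (q0 + q1 * x) + (q2 + q3 * x) * y by ring.
have [->|a0] := eqVneq (q0 + q1 * x) 0.
  rewrite add0r mulf_eq0 negb_or => /andP[b0 y0].
  have [k kE] := eta_val xE Q2 Q3 b0.
  case: hy => [y0'|[_ vy]]; first by rewrite y0' eqxx in y0.
  by exists (2 * k + 1); rewrite valM // kE; lia.
have [j jE] := eta_val xE Q0 Q1 a0.
have [->|b0] := eqVneq ((q2 + q3 * x) * y) 0.
  by rewrite addr0; exists (2 * j); rewrite jE; lia.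
move: b0; rewrite mulf_eq0 negb_or => /andP[b0 y0] _.
have [k kE] := eta_val xE Q2 Q3 b0.
case: hy => [y0'|[_ vy]]; first by rewrite y0' eqxx in y0.
have [||->|->] := @valD_neq _ ((q2 + q3 * x) * y) a0.
- by rewrite mulf_neq0.
- rewrite valM // jE kE => E.
  have /mul_e_inj : (2 * j) * e = (2 * k + 1) * e by lia.
  lia.
- by exists (2 * j); rewrite jE; lia.
- by exists (2 * k + 1); rewrite valM // kE; lia.
Qed.

(** [(1 + x) / y] is a primitive eighth root of unity, since [(1 + x) ^+ 4 = -4]. The hypothesis on
    [y] covers the square roots of 2 and -2 together. *)
Lemma level_zeta8 x y : x ^+ 2 = -1 -> y ^+ 4 = 4 -> fourth_level L = Some 1%N.
Proof.
move=> xE yE; apply: fourth_level_eq; last exact: fourth_sum0.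
apply: (@fourth_sum_seq _ [:: (1 + x) / y]).
rewrite big_cons big_nil exprMn exprVn yE.
have -> : (1 + x) ^+ 4 = (1 + x ^+ 2) ^+ 2 + 4 * (1 + x ^+ 2) * x + 4 * x ^+ 2 by ring.
by rewrite xE; field; rewrite !natr_neq0.
Qed.

Lemma lin_intro x1 x2 x3 y (q0 q1 q2 q3 : L) :
  q0 \in Qbar -> q1 \in Qbar -> q2 \in Qbar -> q3 \in Qbar ->
  y = q0 + q1 * x1 + q2 * x2 + q3 * x3 -> lin x1 x2 x3 y.
Proof. by move=> *; exists q0, q1, q2, q3. Qed.

Lemma lin_int x1 x2 x3 y (c0 c1 c2 c3 : int) :
  y = c0%:~R + c1%:~R * x1 + c2%:~R * x2 + c3%:~R * x3 -> lin x1 x2 x3 y.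
Proof. by apply: lin_intro; apply: Qbar_int. Qed.

(** Because [(1 + x) ^+ 2 = 2 x], the new generator [y] satisfies [y ^+ 2 = 3 s x] and is a unit.
    Then [(y ^+ 2 - 1) ^+ 2 = - 8 - 6 s x] is twice a unit, so [y - 1] has valuation [e / 4]. *)
Lemma level_sqrtN1_sqrt6 (s : int) x b : s \in [:: 1; -1] ->
  x ^+ 2 = -1 -> b ^+ 2 = (6 * s)%:~R -> spanned x b (x * b) ->
  fourth_level L = Some 2%N.
Proof.
move=> s1 xE bE sp; pose y := (1 + x) * b / 2.
have yE : y ^+ 2 = (3 * s)%:~R * x.
  have -> : y ^+ 2 = (1 + 2 * x + x ^+ 2) * b ^+ 2 / 4.
    by rewrite /y; field; rewrite !natr_neq0.
  by rewrite xE bE !intrM; field; rewrite !natr_neq0.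
have xyE : x * y = (x * b - b) / 2.
  have -> : x * y = (x * b + x ^+ 2 * b) / 2 by rewrite /y; field.
  by rewrite xE mulN1r.
have {}sp : spanned x y (x * y).
  apply: spanned_change sp.
  - by apply: (@lin_int _ _ _ _ 0 1 0 0); ring.
  - by apply: (@lin_int _ _ _ _ 0 0 1 (-1)); rewrite xyE /y; field.
  - by apply: (@lin_int _ _ _ _ 0 0 1 1); rewrite xyE /y; field.
move: yE {xyE}; move: y sp => y sp yE.
have ux : vunit x by apply: vunit_sqrt xE; apply/vunitN/vunit1.
have u3s : vunit (3 * s)%:~R.
  by apply: vunit_odd; move: s1; rewrite !inE => /orP[] /eqP ->.
have uy : vunit y by apply: vunit_sqrt yE; apply: vunitM.
have [[_ vx] [_ vy]] := (ux, uy).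
have ix : vge x 0 by right; rewrite vx.
have iy : vge y 0 by right; rewrite vy.
have hx : half2 (1 + x) by apply: (@half2_odd (-1)).
have s2 : s%:~R ^+ 2 = 1 :> L.
  by move: s1; rewrite !inE => /orP[] /eqP ->; ring.
apply: fourth_level_eq.
  have u21 : vunit (2 * x - 1).
    by apply: vunitDr; [apply: vge_two|apply/vunitN/vunit1].
  (* The two fourth powers add up to [95 - 16 y - 8 (27 + 9 s) x - 48 s x y], and 95 is -1 modulo
     16. *)
  apply: (@fourth_sum_hensel ((2 * x - 1) * y) [:: (1 + x) * (1 + y)]).
    exact: vunitM.
  rewrite big_cons big_nil.
  have x14 : (1 + x) ^+ 4 = -4.
    have -> : (1 + x) ^+ 4 = (1 + x ^+ 2) ^+ 2 + 4 * (1 + x ^+ 2) * x + 4 * x ^+ 2 by ring.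
    by rewrite xE; ring.
  have x24 : (2 * x - 1) ^+ 4 = 24 * x - 7.
    have -> : (2 * x - 1) ^+ 4 = (4 * x ^+ 2 - 4 * x + 1) ^+ 2 by ring.
    rewrite xE.
    have -> : (4 * -1 - 4 * x + 1) ^+ 2 = 9 + 24 * x + 16 * x ^+ 2 by ring.
    by rewrite xE; ring.
  have y4 : y ^+ 4 = - 9.
    by rewrite -[4%N]/(2 * 2)%N exprM yE exprMn xE intrM exprMn s2; ring.
  have y14 : (1 + y) ^+ 4 = -8 + 4 * y + 18 * s%:~R * x + 12 * s%:~R * x * y.
    have -> : (1 + y) ^+ 4 = 1 + 4 * y + 6 * y ^+ 2 + 4 * y ^+ 2 * y + y ^+ 4 by ring.
    by rewrite y4 yE intrM; ring.
  rewrite !exprMn x14 x24 y14 y4.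
  (* Oddness of [s] supplies the factor 2 that turns the coefficient 8 of [x] into 16. *)
  have [c cE] : exists c : int, 27 + 9 * s = 2 * c.
    by move: s1; rewrite !inE => /orP[] /eqP ->; [exists 18|exists 9].
  have cL : 27 + 9 * s%:~R = 2 * c%:~R :> L.
    by have := congr1 (fun z : int => z%:~R : L) cE; rewrite intrD !intrM.
  rewrite [X in vge X](_ : _ =
    2 ^+ 4 * (-6 + y + 3 * s%:~R * x * y) + 8 * (27 + 9 * s%:~R) * x); last by ring.
  rewrite cL (_ : 8 * _ * x = 2 ^+ 4 * (c%:~R * x)); last by ring.
  by rewrite -mulrDr; apply: (vge_pow2M 4); vge_integral.
apply: (@spanned_no_fourth_sum x y true true (-1) 0 (3 * s)) => //.
- by rewrite yE add0r.
- apply: splits_ram4 => //; apply: quarter2_sqr.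
  apply: (@half2_sqr _ (-4 - (3 * s)%:~R * x)).
    apply: vunitDr; last by apply/vunitN/vunitM.
    have -> : -4 = 2 * -2 :> L by ring.
    by apply: vge_two; vge_integral.
  rewrite yE sqrrB1 exprMn xE intrM exprMn s2; ring.
- by apply: Q2_sqrtN1_sqrt6_check; move: s1; rewrite !inE => /orP[] /eqP ->.
Qed.

(** Here [(1 + x) ^+ 2 = 2 (2 + x)], so [y ^+ 2 = s (2 + x)], where [2 + x] is a unit with inverse
    [2 - x]. *)
Lemma level_sqrt3_sqrt2 (s : int) x b : s \in [:: 1; -1] ->
  x ^+ 2 = 3 -> b ^+ 2 = (2 * s)%:~R -> spanned x b (x * b) ->
  fourth_level L = Some 3%N.
Proof.
move=> s1 xE bE sp; pose y := (1 + x) * b / 2.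
have yE : y ^+ 2 = (2 * s)%:~R + s%:~R * x.
  have -> : y ^+ 2 = (1 + 2 * x + x ^+ 2) * b ^+ 2 / 4.
    by rewrite /y; field; rewrite !natr_neq0.
  by rewrite xE bE !intrM; field; rewrite !natr_neq0.
have xyE : x * y = (x * b + 3 * b) / 2.
  have -> : x * y = (x * b + x ^+ 2 * b) / 2 by rewrite /y; field.
  by rewrite xE.
have {}sp : spanned x y (x * y).
  apply: spanned_change sp.
  - by apply: (@lin_int _ _ _ _ 0 1 0 0); ring.
  - by apply: (@lin_int _ _ _ _ 0 0 (-1) 1); rewrite xyE /y; field.
  - by apply: (@lin_int _ _ _ _ 0 0 3 (-1)); rewrite xyE /y; field.
move: yE {xyE}; move: y sp => y sp yE.
have ux : vunit x by apply: vunit_sqrt xE; apply: (@vunit_odd 3).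
have ix : vge x 0 by case: ux => _ vx; right; rewrite vx.
have us : vunit s%:~R.
  by apply: vunit_odd; move: s1; rewrite !inE => /orP[] /eqP ->.
have hx : half2 (1 + x) by apply: (@half2_odd 3).
have s2 : s%:~R ^+ 2 = 1 :> L.
  by move: s1; rewrite !inE => /orP[] /eqP ->; ring.
apply: fourth_level_eq.
  (* As [2 - x] inverts [2 + x], the fourth powers of [y] and [(2 - x) y] are the conjugates
     [7 + 4 x] and [7 - 4 x]; together with 1 they give 15. *)
  apply: (@fourth_sum_hensel 1 [:: y; (2 - x) * y] vunit1).
  rewrite !big_cons big_nil.
  have y4 : y ^+ 4 = 7 + 4 * x.
    rewrite -[4%N]/(2 * 2)%N exprM yE.
    have -> : ((2 * s)%:~R + s%:~R * x) ^+ 2 = s%:~R ^+ 2 * (4 + 4 * x + x ^+ 2).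
      by rewrite intrM; ring.
    by rewrite s2 xE; ring.
  have E : (2 - x) ^+ 4 = 97 - 56 * x.
    have -> : (2 - x) ^+ 4 = (4 - 4 * x + x ^+ 2) ^+ 2 by ring.
    rewrite xE.
    have -> : (4 - 4 * x + 3) ^+ 2 = 49 - 56 * x + 16 * x ^+ 2 by ring.
    by rewrite xE; ring.
  rewrite exprMn y4 E.
  have -> : (97 - 56 * x) * (7 + 4 * x) = 679 - 4 * x - 224 * x ^+ 2 by ring.
  rewrite xE [X in vge X](_ : _ = 2 ^+ 4 * -1); last by ring.
  by apply: (vge_pow2M 4); vge_integral.
apply: (@spanned_no_fourth_sum x y true true 3 (2 * s) s) => //.
- apply: splits_ram4 => //; apply: quarter2_sqr; rewrite yE.
  move: s1; rewrite !inE => /orP[] /eqP ->.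
    by have -> : (2 * 1)%:~R + 1%:~R * x - 1 = 1 + x by ring.
  apply: (@half2_sqr _ (3 * (2 + x))).
    apply: vunitM; first by apply: (@vunit_odd 3).
    by apply: vunitDr => //; right.
  have -> : ((2 * -1)%:~R + (-1)%:~R * x - 1) ^+ 2 = 9 + 6 * x + x ^+ 2 by ring.
  by rewrite xE; ring.
- exact: Q2_sqrt3_sqrt2_check.
Qed.

Lemma intr_injL : injective (fun c : int => c%:~R : L).
Proof.
move=> a b /eqP; rewrite -subr_eq0 -intrB => ab; apply/eqP; rewrite -subr_eq0.
by apply: contraTT ab => /intr_neq0.
Qed.

Lemma sqclass_refl (a : int) : a != 0 -> sqclass a a.
Proof. by exists a, 1; rewrite expr2 mulr1. Qed.

Lemma sqclass_odd (A a : int) : A \in [:: 1; -1; 3; -3] -> (a = A %[mod 8])%Z ->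
  sqclass a A.
Proof.
rewrite !inE => A1 aA; exists 1, (a * A); rewrite expr1n mul1r.
by move: A1 => /or4P[] /eqP E; subst A; split=> //; lia.
Qed.

Lemma sqclass_even (A a : int) : A \in [:: 1; -1; 3; -3] -> (a = 2 * A %[mod 16])%Z ->
  sqclass a (2 * A).
Proof.
rewrite !inE => A1 aA; exists 2, ((a %/ 2)%Z * A).
by move: A1 => /or4P[] /eqP E; subst A; split=> //; lia.
Qed.

(** * Radical triples *)

(** The relation [x y z = t] says symmetrically that [z] is a rational multiple of [x y]; the
    property is thus stable under permutation of the radicands. *)
Definition rad_triple (a b c : int) := exists x y z (t : int),
  [/\ x ^+ 2 = a%:~R, y ^+ 2 = b%:~R & z ^+ 2 = c%:~R] /\
  [/\ t != 0, x * y * z = t%:~R & spanned x y z].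

Lemma rad_triple_swap12 a b c : rad_triple a b c -> rad_triple b a c.
Proof.
move=> [x [y [z [t [[xE yE zE] [t0 tE sp]]]]]].
exists y, x, z, t; do 2 split=> //; first by rewrite [y * x]mulrC.
apply: spanned_change sp.
- by apply: (@lin_int _ _ _ _ 0 0 1 0); ring.
- by apply: (@lin_int _ _ _ _ 0 1 0 0); ring.
- by apply: (@lin_int _ _ _ _ 0 0 0 1); ring.
Qed.

Lemma rad_triple_swap23 a b c : rad_triple a b c -> rad_triple a c b.
Proof.
move=> [x [y [z [t [[xE yE zE] [t0 tE sp]]]]]].
exists x, z, y, t; do 2 split=> //; first by rewrite mulrAC.
apply: spanned_change sp.
- by apply: (@lin_int _ _ _ _ 0 1 0 0); ring.
- by apply: (@lin_int _ _ _ _ 0 0 0 1); ring.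
- by apply: (@lin_int _ _ _ _ 0 0 1 0); ring.
Qed.

Lemma rad_triple_prod a b c : rad_triple a b c ->
  [/\ a != 0, b != 0 & exists2 t : int, t != 0 & a * b * c = t ^+ 2].
Proof.
move=> [x [y [z [t [[xE yE zE] [t0 tE _]]]]]].
have E : a * b * c = t ^+ 2.
  by apply: intr_injL; rewrite /= rmorphXn /= -tE !exprMn xE yE zE !intrM.
have : a * b * c != 0 by rewrite E sqrf_eq0.
by rewrite !mulf_eq0 !negb_or => /andP[/andP[]]; split=> //; exists t.
Qed.

Lemma rad_triple_reduce a b c A B : rad_triple a b c -> sqclass a A -> sqclass b B ->
  exists x y, [/\ x ^+ 2 = A%:~R, y ^+ 2 = B%:~R & spanned x y (x * y)].
Proof.
move=> /[dup] /rad_triple_prod[a0 b0 _] [x [y [z [t [[xE yE zE] [t0 tE sp]]]]]].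
move=> /sqclass_sqrt-/(_ _ xE)[q [x' [Qq xx' x'E]]].
move=> /sqclass_sqrt-/(_ _ yE)[r [y' [Qr yy' y'E]]].
exists x', y'; split=> //; apply: spanned_change sp.
- by apply: (@lin_intro _ _ _ _ 0 q 0 0); rewrite ?rpred0 // xx'; ring.
- by apply: (@lin_intro _ _ _ _ 0 0 r 0); rewrite ?rpred0 // yy'; ring.
- apply: (@lin_intro _ _ _ _ 0 0 0 (t%:~R / (a%:~R * b%:~R) * (q * r))); rewrite ?rpred0 //.
    by rewrite invfM !rpredM ?Qbar_int ?Qbar_intV.
  have a0' := intr_neq0 a0; have b0' := intr_neq0 b0.
  have zt : z * (x ^+ 2 * y ^+ 2) = t%:~R * (x * y) by rewrite -tE; ring.
  rewrite xE yE in zt; rewrite -[z](mulfK (mulf_neq0 a0' b0')) zt xx' yy'.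
  field; exact/andP.
Qed.

Lemma rad_triple_reduce1 a b c B : rad_triple a b c -> sqclass a 1 -> sqclass b B ->
  exists2 y, y ^+ 2 = B%:~R & spanned y 0 0.
Proof.
move=> h ha hb; have [x [y [xE yE sp]]] := rad_triple_reduce h ha hb.
have Qx : x \in Qbar.
  by apply: sqclass1_Qbar xE; exists 1, 1.
exists y => //; apply: spanned_change sp.
- by apply: (@lin_intro _ _ _ _ x 0 0 0); rewrite ?rpred0 //; ring.
- by apply: (@lin_intro _ _ _ _ 0 1 0 0); rewrite ?rpred0 ?rpred1 //; ring.
- by apply: (@lin_intro _ _ _ _ 0 x 0 0); rewrite ?rpred0 //; ring.
Qed.

Lemma level_1mod8_1mod8 a b c : rad_triple a b c ->
  (a = 1 %[mod 8])%Z -> (b = 1 %[mod 8])%Z -> fourth_level L = Some 15%N.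
Proof.
move=> h a1 b1.
have [y yE sp] := rad_triple_reduce1 h (@sqclass_odd 1 _ isT a1) (@sqclass_odd 1 _ isT b1).
have Qy : y \in Qbar by apply: sqclass1_Qbar yE; exists 1, 1.
apply: level_Q2; apply: spanned_change sp.
- by apply: (@lin_intro _ _ _ _ y 0 0 0); rewrite ?rpred0 //; ring.
- by apply: (@lin_int _ _ _ _ 0 0 0 0); ring.
- by apply: (@lin_int _ _ _ _ 0 0 0 0); ring.
Qed.

Lemma level_1mod8_5mod8 a b c : rad_triple a b c ->
  (a = 1 %[mod 8])%Z -> (b = 5 %[mod 8])%Z -> fourth_level L = Some 2%N.
Proof.
move=> h a1 b5.
have [y yE sp] := rad_triple_reduce1 h (@sqclass_odd 1 _ isT a1) (@sqclass_odd (-3) _ isT b5).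
by apply: (level_sqrtN3 yE (or_introl erefl)); rewrite mulr0.
Qed.

Lemma level_1mod8_3mod4 a b c : rad_triple a b c ->
  (a = 1 %[mod 8])%Z -> (b = 3 %[mod 4])%Z -> fourth_level L = Some 4%N.
Proof.
move=> h a1 b3.
have [B B13 bB] : exists2 B : int, B \in [:: -1; 3] & sqclass b B.
  have [b8|b8] : (b = 3 %[mod 8])%Z \/ (b = -1 %[mod 8])%Z by lia.
    by exists 3 => //; apply: sqclass_odd.
  by exists (-1) => //; apply: sqclass_odd.
have [y yE sp] := rad_triple_reduce1 h (@sqclass_odd 1 _ isT a1) bB.
exact: level_sqrt_odd yE sp.
Qed.

Lemma sqclass_2mod4 (b : int) : (b = 2 %[mod 4])%Z ->
  exists2 B, B \in [:: 2; -2; 6; -6] & sqclass b B /\ (b = B %[mod 16])%Z.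
Proof.
move=> b2.
have [b8|[b8|[b8|b8]]] : (b = 2 %[mod 16])%Z \/ (b = -2 %[mod 16])%Z \/
    (b = 6 %[mod 16])%Z \/ (b = -6 %[mod 16])%Z by lia.
- by exists 2 => //; split=> //; apply: (@sqclass_even 1).
- by exists (-2) => //; split=> //; apply: (@sqclass_even (-1)).
- by exists 6 => //; split=> //; apply: (@sqclass_even 3).
- by exists (-6) => //; split=> //; apply: (@sqclass_even (-3)).
Qed.

Lemma level_1mod8_2mod4 a b c : rad_triple a b c ->
  (a = 1 %[mod 8])%Z -> (b = 2 %[mod 4])%Z -> fourth_level L = Some 6%N.
Proof.
move=> h a1 /sqclass_2mod4[B hB [bB _]].
have [y yE sp] := rad_triple_reduce1 h (@sqclass_odd 1 _ isT a1) bB.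
exact: level_sqrt_even yE sp.
Qed.

Lemma level_5mod8_3mod4 a b c : rad_triple a b c ->
  (a = 5 %[mod 8])%Z -> (b = 3 %[mod 4])%Z -> fourth_level L = Some 2%N.
Proof.
move=> h a5 b3; have [_ b0 _] := rad_triple_prod h.
have [x [y [xE yE sp]]] := rad_triple_reduce h (@sqclass_odd (-3) _ isT a5) (sqclass_refl b0).
(* [y] is a unit; [1 + y] is the element of valuation [e / 2]. *)
apply: (@level_sqrtN3 x (1 + y) xE); first by right; apply: half2_odd yE.
apply: spanned_change sp.
- by apply: (@lin_int _ _ _ _ 0 1 0 0); ring.
- by apply: (@lin_int _ _ _ _ (-1) 0 1 0); ring.
- by apply: (@lin_int _ _ _ _ 0 (-1) 0 1); ring.
Qed.

Lemma level_5mod8_2mod4 a b c : rad_triple a b c ->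
  (a = 5 %[mod 8])%Z -> (b = 2 %[mod 4])%Z -> fourth_level L = Some 2%N.
Proof.
move=> h a5 b2; have [_ b0 _] := rad_triple_prod h.
have [x [y [xE yE sp]]] := rad_triple_reduce h (@sqclass_odd (-3) _ isT a5) (sqclass_refl b0).
apply: (level_sqrtN3 xE _ sp); right; apply: (@half2_even (b %/ 2)%Z); first by lia.
by rewrite yE; congr (_%:~R); lia.
Qed.

Lemma level_7mod8_2mod16 a b c : rad_triple a b c ->
  (a = 7 %[mod 8])%Z -> (b = 2 %[mod 16])%Z \/ (b = -2 %[mod 16])%Z ->
  fourth_level L = Some 1%N.
Proof.
move=> h a7 hb.
have [B [B2 bB]] : exists B : int, B ^+ 2 = 4 /\ sqclass b B.
  case: hb => hb; first by exists 2; split=> //; apply: (@sqclass_even 1).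
  by exists (-2); split=> //; apply: (@sqclass_even (-1)).
have [x [y [xE yE sp]]] := rad_triple_reduce h (@sqclass_odd (-1) _ isT a7) bB.
apply: (level_zeta8 xE (y := y)).
by rewrite -[4%N]/(2 * 2)%N exprM yE -rmorphXn /= B2.
Qed.

Lemma level_7mod8_6mod16 a b c : rad_triple a b c ->
  (a = 7 %[mod 8])%Z -> (b = 6 %[mod 16])%Z \/ (b = -6 %[mod 16])%Z ->
  fourth_level L = Some 2%N.
Proof.
move=> h a7 hb.
have [s s1 bB] : exists2 s : int, s \in [:: 1; -1] & sqclass b (6 * s).
  case: hb => hb; first by exists 1 => //; apply: (@sqclass_even 3).
  by exists (-1) => //; apply: (@sqclass_even (-3)).
have [x [y [xE yE sp]]] := rad_triple_reduce h (@sqclass_odd (-1) _ isT a7) bB.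
exact: level_sqrtN1_sqrt6 s1 xE yE sp.
Qed.

Lemma level_3mod8_2mod16 a b c : rad_triple a b c ->
  (a = 3 %[mod 8])%Z -> (b = 2 %[mod 16])%Z \/ (b = -2 %[mod 16])%Z ->
  fourth_level L = Some 3%N.
Proof.
move=> h a3 hb.
have [s s1 bB] : exists2 s : int, s \in [:: 1; -1] & sqclass b (2 * s).
  case: hb => hb; first by exists 1 => //; apply: (@sqclass_even 1).
  by exists (-1) => //; apply: (@sqclass_even (-1)).
have [x [y [xE yE sp]]] := rad_triple_reduce h (@sqclass_odd 3 _ isT a3) bB.
exact: level_sqrt3_sqrt2 s1 xE yE sp.
Qed.

Lemma rad_triple_levels a b c : rad_triple a b c -> level_spec (fourth_level L) a b c.
Proof.
move=> h; have [a0 b0 [t t0 E]] := rad_triple_prod h; split=> -[a4 b4 c4] /=.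
- have P8 := case1_mod8 a4 b4 c4 E.
  have [/propext -> /propext -> E3 E3'] := case1_arith b4 c4; split.
  + by move=> [P7]; apply: (level_7mod8_2mod16 h); rewrite -P8.
  + by move=> [P7]; apply: (level_7mod8_6mod16 h); rewrite -P8.
  + move=> /E3 P3; have a3 : (a = 3 %[mod 8])%Z by rewrite -P8.
    (* The radicand congruent to 2 or -2 modulo 16 may be [c] instead of [b]; the triple is then
       reordered. *)
    have [] := E3' P3; first exact: (level_3mod8_2mod16 h).
    exact: (level_3mod8_2mod16 (rad_triple_swap23 h)).
  + have [a3|a7] : (a = 3 %[mod 8])%Z \/ (a = 7 %[mod 8])%Z by lia.
      by apply: Or33; apply/E3; rewrite P8.
    have {}P8 : (((b * c) %/ 4)%Z = 7 %[mod 8])%Z by rewrite P8.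
    have [b16|b16] : ((b = 2 %[mod 16])%Z \/ (b = -2 %[mod 16])%Z) \/
        ((b = 6 %[mod 16])%Z \/ (b = -6 %[mod 16])%Z) by lia.
      exact: Or31.
    exact: Or32.
- by split=> a8; [apply: level_1mod8_3mod4 h _ _|apply: level_5mod8_3mod4 h _ _].
- by split=> a8; [apply: level_1mod8_2mod4 h _ _|apply: level_5mod8_2mod4 h _ _].
- split=> [[a1 b1 _]|nall]; first exact: level_1mod8_1mod8 h _ _.
  case: (case4_mod8 a4 b4 c4 E) => [//|[a1 b5 _]|[a5 b1 _]|[a5 _ c1]].
  + exact: level_1mod8_5mod8 h _ _.
  + exact: level_1mod8_5mod8 (rad_triple_swap12 h) _ _.
  + exact: level_1mod8_5mod8 (rad_triple_swap12 (rad_triple_swap23 h)) _ _.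
Qed.

End Valuation.

(** * Biquadratic fields *)

Section Biquadratic.
Variables (K : fieldExtType rat).
Implicit Types x y : K.

Lemma Fadjoin_sqrt (E : {subfield K}) (a x : K) : a ^+ 2 \in E ->
  x \in <<E; a>>%VS -> exists s t, [/\ s \in E, t \in E & x = s + t * a].
Proof.
move=> a2 /Fadjoin_polyP[p /polyOverP pE ->]; rewrite horner_coef.
apply: (big_ind (fun w => exists s t, [/\ s \in E, t \in E & w = s + t * a])).
- by exists 0, 0; rewrite rpred0 mul0r addr0.
- move=> u w [s [t [sE tE ->]]] [s' [t' [sE' tE' ->]]].
  by exists (s + s'), (t + t'); rewrite !rpredD //; split=> //; ring.
move=> i _; have [s [t [sE tE ->]]] : exists s t, [/\ s \in E, t \in E & a ^+ i = s + t * a].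
  elim: (nat_of_ord i) => [|k [s [t [sE tE IH]]]].
    by exists 1, 0; rewrite rpred0 rpred1 expr0 mul0r addr0.
  by exists (t * a ^+ 2), s; rewrite rpredM // exprS IH; split=> //; ring.
exists (p`_i * s), (p`_i * t); rewrite !rpredM //; split=> //; ring.
Qed.

Lemma biquadratic_span (m n : int) (a b : K) :
  a ^+ 2 = m%:~R -> b ^+ 2 = n%:~R -> <<1 & [:: a; b]>>%VS = {:K}%VS ->
  forall x, exists q0 q1 q2 q3 : rat,
    x = q0%:A + q1%:A * a + q2%:A * b + q3%:A * (a * b).
Proof.
move=> aE bE gen x; have := memvf x; rewrite -gen adjoin_cons adjoin_seq1.
have int_in (E : {subfield K}) (c : int) : c%:~R \in E by rewrite rpred_int.
move=> /Fadjoin_sqrt[|s [t [sE tE ->]]]; first by rewrite bE.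
have D w : w \in <<1; a>>%VS -> exists q q' : rat, w = q%:A + q'%:A * a.
  move=> /(@Fadjoin_sqrt 1%AS)[|u [u' [/vlineP[q ->] /vlineP[q' ->] ->]]].
    by rewrite aE.
  by exists q, q'.
have [q0 [q1 ->]] := D _ sE; have [q2 [q3 ->]] := D _ tE.
by exists q0, q1, q2, q3; ring.
Qed.

End Biquadratic.

(** * Powers of a prime above 2 and permutations of the triple *)

Section PrimeAbove2.
Variables (R : comNzRingType) (I : set R).

Lemma idealX_sub n : (idealX I n.+1 `<=` idealX I n)%classic.
Proof.
elim: n => [//|n IH] x [s [sI ->]]; exists s; split=> // u /sI[u1 u2].
by split=> //; apply: IH.
Qed.

Lemma idealX_le i j : (i <= j)%N -> (idealX I j `<=` idealX I i)%classic.
Proof.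
move=> /subnK <-; elim: (j - i)%N => [//|k IH] x /idealX_sub; exact: IH.
Qed.

Lemma idealX_mul n a b : I a -> idealX I n b -> idealX I n.+1 (a * b).
Proof.
by move=> Ia Ib; exists [:: (a, b)]; split=> [u|]; rewrite ?big_seq1 // inE => /eqP ->.
Qed.

End PrimeAbove2.

Lemma idealr_dvd_mem (R : comNzRingType) (p : idealr R) (a : R) :
  ideal_dvd [set` p]%classic (principal a) -> a \in p.
Proof.
move=> [H [_ E]]; have : principal a a by exists 1; rewrite ?mul1r.
rewrite -E => -[s [sp ->]]; rewrite big_seq; apply: rpred_sum => u /sp[u1 _].
by rewrite mulrC idealMr.
Qed.

(** If [x = a / b] had valuation at most 0, then [a = x b] would lie in one power of [p] more than
    [b], beyond its own order. No unique factorisation of ideals is involved. *)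
Lemma padic_val_gt0 (K : fieldExtType rat) (p : set (ring_of_integers K))
    (x : ring_of_integers K) (z : int) :
  p x -> padic_val p (x : K) z -> 0 < z.
Proof.
move=> px [a [b [i [j [b0 xE [ia nia] [jb njb] ->]]]]].
have aE : a = x * b.
  apply: val_inj; rewrite [RHS](rmorphM val) /= xE divfK //.
have : (j < i)%N.
  rewrite ltnNge; apply/negP => ij; apply: nia; rewrite aE.
  by apply: idealX_le (idealX_mul px jb).
by lia.
Qed.

Lemma perm3_ind (T : eqType) (P : T -> T -> T -> Prop) (a b c x y z : T) :
  (forall u v w, P u v w -> P v u w) -> (forall u v w, P u v w -> P u w v) ->
  perm_eq [:: a; b; c] [:: x; y; z] -> P x y z -> P a b c.
Proof.
move=> s12 s23 pm Pxyz.
have pair (u v u' v' : T) : perm_eq [:: u; v] [:: u'; v'] ->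
    (u = u' /\ v = v') \/ (u = v' /\ v = u').
  move=> h; have : u \in [:: u'; v'] by rewrite -(perm_mem h) inE eqxx.
  rewrite !inE => /orP[] /eqP E; subst u; [left|right]; split=> //.
    by move: h; rewrite perm_cons => /perm_small_eq -/(_ isT)[].
  have : perm_eq [:: v'; v] [:: v'; u'] by rewrite (perm_trans h) // (perm_catC [:: _] [:: _]).
  by rewrite perm_cons => /perm_small_eq -/(_ isT)[].
have : a \in [:: x; y; z] by rewrite -(perm_mem pm) inE eqxx.
rewrite !inE => /or3P[] /eqP E; subst a.
- by move: pm; rewrite perm_cons => /pair[] [-> ->] //; apply/s23.
- have : perm_eq [:: y; b; c] [:: y; x; z].
    by rewrite (perm_trans pm) //; apply/permP => q /=; rewrite addnCA.
  by rewrite perm_cons => /pair[] [-> ->]; [|apply/s23]; apply/s12.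
- have : perm_eq [:: z; b; c] [:: z; x; y].
    by rewrite (perm_trans pm) //; apply/permP => q /=; lia.
  by rewrite perm_cons => /pair[] [-> ->]; [|apply/s23]; apply/s12/s23.
Qed.

Lemma squarefree_mod4 m : squarefree m -> (m %% 4)%Z <> 0.
Proof. by move=> /(_ 2) h m4; have := h (introT dvdz_mod0P m4). Qed.

Lemma mod4M (a b : int) : ((a * b) %% 4)%Z = (((a %% 4)%Z * (b %% 4)%Z) %% 4)%Z.
Proof. by rewrite modzMmr modzMml. Qed.

(** With [d] the gcd and [x y] the third radicand: for odd [d], [x y] is [m n] modulo 4 and [m], [n]
    are not both even; for even [d], [x] and [y] are odd and [m], [n] are both 2 modulo 4. *)
Lemma biquadratic_mod4 (m n d x y : int) :
  (m %% 4)%Z <> 0 -> (n %% 4)%Z <> 0 -> m = x * d -> n = y * d ->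
  ((m %% 2)%Z = 0 -> (n %% 2)%Z = 0 -> (d %% 2)%Z = 0) ->
  ((m %% 4)%Z, (n %% 4)%Z, ((x * y) %% 4)%Z) \in
    [:: (3, 2, 2); (2, 3, 2); (2, 2, 3); (1, 3, 3); (3, 1, 3); (3, 3, 1);
        (1, 2, 2); (2, 1, 2); (2, 2, 1); (1, 1, 1) : int * int * int].
Proof.
move=> m4 n4 mE nE.
have -> : (m %% 2)%Z = ((m %% 4)%Z %% 2)%Z by lia.
have -> : (n %% 2)%Z = ((n %% 4)%Z %% 2)%Z by lia.
have -> : (d %% 2)%Z = ((d %% 4)%Z %% 2)%Z by lia.
move: m4 n4; rewrite mE nE !(mod4M x, mod4M y).
have res (z : int) : [\/ (z %% 4)%Z = 0, (z %% 4)%Z = 1, (z %% 4)%Z = 2 | (z %% 4)%Z = 3].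
  have : (z %% 4)%Z = 0 \/ (z %% 4)%Z = 1 \/ (z %% 4)%Z = 2 \/ (z %% 4)%Z = 3 by lia.
  by case=> [|[|[]]] zE; [apply: Or41|apply: Or42|apply: Or43|apply: Or44].
by case: (res x) => ->; case: (res y) => ->; case: (res d) => -> // _ _ /(_ erefl erefl).
Qed.

Section Embedding.
Variables (m n : int).
Hypotheses (m_sqfree : squarefree m) (n_sqfree : squarefree n).
Variables (K : fieldExtType rat) (sqrtm sqrtn : K).
Hypothesis sqrtmE : sqrtm ^+ 2 = m%:~R.
Hypothesis sqrtnE : sqrtn ^+ 2 = n%:~R.
Hypothesis genK : <<1 & [:: sqrtm; sqrtn]>>%VS = {:K}%VS.
Variables (p : prime_idealr (ring_of_integers K)).
Hypothesis p_dvd2 : ideal_dvd [set` p]%classic (principal 2).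
Variables (L : fieldType) (v : L -> int) (iota : {rmorphism K -> L}).
Hypothesis compl : is_padic_completion [set` p]%classic v iota.

Lemma squarefree_neq0 (c : int) : squarefree c -> c != 0.
Proof. by move=> /squarefree_mod4 c4; apply/eqP => c0; apply: c4; rewrite c0. Qed.

Lemma fieldExt_intr_neq0 (c : int) : c != 0 -> c%:~R != 0 :> K.
Proof.
move=> c0; rewrite -(rmorph_int (in_alg K)) fmorph_eq0 intr_eq0 //.
Qed.

Lemma two_neq0L : (2 : L) != 0.
Proof. by rewrite -(rmorph_nat iota) fmorph_eq0 (@fieldExt_intr_neq0 2). Qed.

Lemma v2_gt0L : 0 < v 2.
Proof.
have [_ _ ext _] := compl.
have two0 : (2 : K) != 0 := @fieldExt_intr_neq0 2 isT.
apply: (@padic_val_gt0 K [set` p]%classic 2); first exact: (idealr_dvd_mem p_dvd2).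
have -> : v 2 = v (iota 2) by rewrite rmorph_nat.
exact/(ext 2).
Qed.

Lemma rat_Qbar (q : rat) : iota q%:A \in Qbar v.
Proof.
have [vv vc _ _] := compl.
have [d0 qE] := (denq_neq0 q, divq_num_den q).
have -> : iota q%:A = (numq q)%:~R / (denq q)%:~R.
  have -> : q%:A = in_alg K ((numq q)%:~R / (denq q)%:~R) by rewrite qE.
  by rewrite (fmorph_div (in_alg K)) fmorph_div !rmorph_int.
have [_ _] := Qbar_subring vv two_neq0L v2_gt0L; apply; first exact: Qbar_int.
exact: (Qbar_intV vv two_neq0L v2_gt0L).
Qed.

Lemma rad_triple_biquadratic (d x y : int) : d != 0 -> m = x * d -> n = y * d ->
  rad_triple v m n (x * y).
Proof.
move=> d0 mE nE; have [_ _ _ dense] := compl; have [vv _ _ _] := compl.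
have d0K := fieldExt_intr_neq0 d0.
have x0 : x != 0.
  by apply: contraNneq (squarefree_neq0 m_sqfree) => x0; rewrite mE x0 mul0r.
pose z := sqrtm * sqrtn / d%:~R.
(* The product of the three roots is [m n / d = x n]. *)
exists (iota sqrtm), (iota sqrtn), (iota z), (x * n); split.
  split; rewrite -rmorphXn /= ?sqrtmE ?sqrtnE ?rmorph_int // /z.
  have -> : (sqrtm * sqrtn / d%:~R) ^+ 2 = (x * y)%:~R.
    by rewrite !exprMn sqrtmE sqrtnE mE nE !intrM; field.
  by rewrite rmorph_int.
split.
- by rewrite mulf_neq0 // squarefree_neq0.
- rewrite -!rmorphM /= -(rmorph_int iota); congr (iota _).
  have -> : sqrtm * sqrtn * z = sqrtm ^+ 2 * sqrtn ^+ 2 / d%:~R by rewrite /z; field.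
  by rewrite sqrtmE sqrtnE mE nE !intrM; field.
move=> u N; have [w uw] := dense u N; exists (iota w) => //.
have [q0 [q1 [q2 [q3 ->]]]] := biquadratic_span sqrtmE sqrtnE genK w.
apply: (@lin_intro _ _ _ _ _ _ (iota q0%:A) (iota q1%:A) (iota q2%:A)
  (iota (q3 * d%:~R)%:A)); rewrite ?rat_Qbar //.
rewrite -!rmorphM -!rmorphD /=; congr (iota _); congr (_ + _).
have -> : (q3 * d%:~R)%:A = q3%:A * d%:~R :> K.
  by rewrite -[LHS]/(in_alg K _) rmorphM rmorph_int.
by rewrite /z; field.
Qed.

End Embedding.

Theorem theorem3p1 (m n : int)
  (m_sqfree : squarefree m) (n_sqfree : squarefree n)
  (m_neq1 : m <> 1) (n_neq1 : n <> 1) (m_neq_n : m <> n)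
  (K : fieldExtType rat) (sqrtm sqrtn : K)
  (sqrtmE : sqrtm ^+ 2 = m%:~R) (sqrtnE : sqrtn ^+ 2 = n%:~R)
  (genK : <<1 & [:: sqrtm; sqrtn]>>%VS = {:K}%VS)
  (p : prime_idealr (ring_of_integers K))
  (p_dvd2 : ideal_dvd [set` p]%classic (principal 2))
  (Kp : fieldType) (v : Kp -> int) (iota : {rmorphism K -> Kp})
  (Kp_completion : is_padic_completion [set` p]%classic v iota) :
  let d := gcdz m n in
  let k := ((m * n) %/ d ^+ 2)%Z in
  let s := fourth_level Kp in
  let cong4 (a b c r1 r2 r3 : int) :=
    [/\ (a = r1 %[mod 4])%Z, (b = r2 %[mod 4])%Z & (c = r3 %[mod 4])%Z] in
  let case1_s1 (b c : int) :=
    ((32 %| b + c)%Z /\ (((b * c) %/ 4)%Z = 15 %[mod 16])%Z) \/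
    (exact_pow2 4 (b + c) /\ (((b * c) %/ 4)%Z = 7 %[mod 16])%Z) in
  let case1_s2 (b c : int) :=
    ((32 %| b + c)%Z /\ (((b * c) %/ 4)%Z = 7 %[mod 16])%Z) \/
    (exact_pow2 4 (b + c) /\ (((b * c) %/ 4)%Z = 15 %[mod 16])%Z) in
  let case1_s3 (b c : int) := exact_pow2 3 (b + c) in
  [/\ s \in [:: Some 1; Some 2; Some 3; Some 4; Some 6; Some 15]%N,
      (exists a b c : int, perm_eq [:: a; b; c] [:: m; n; k] /\
         [\/ cong4 a b c 3 2 2, cong4 a b c 1 3 3,
             cong4 a b c 1 2 2 | cong4 a b c 1 1 1])
    & (forall a b c : int, perm_eq [:: a; b; c] [:: m; n; k] ->
        [/\ cong4 a b c 3 2 2 ->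
              [/\ case1_s1 b c -> s = Some 1%N,
                  case1_s2 b c -> s = Some 2%N,
                  case1_s3 b c -> s = Some 3%N
                & [\/ case1_s1 b c, case1_s2 b c | case1_s3 b c]],
            cong4 a b c 1 3 3 ->
              ((a = 1 %[mod 8])%Z -> s = Some 4%N) /\
              ((a = 5 %[mod 8])%Z -> s = Some 2%N),
            cong4 a b c 1 2 2 ->
              ((a = 1 %[mod 8])%Z -> s = Some 6%N) /\
              ((a = 5 %[mod 8])%Z -> s = Some 2%N)
          & cong4 a b c 1 1 1 ->
              let all1mod8 :=
                [/\ (a = 1 %[mod 8])%Z, (b = 1 %[mod 8])%Z
                  & (c = 1 %[mod 8])%Z] in
              (all1mod8 -> s = Some 15%N) /\ (~ all1mod8 -> s = Some 2%N)])].
Proof.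
have m0 := squarefree_neq0 m_sqfree; have n0 := squarefree_neq0 n_sqfree.
move=> d k s cong4 case1_s1 case1_s2 case1_s3.
have d0 : d != 0 by rewrite gcdz_eq0 negb_and m0.
have /dvdzP[x mE] := dvdz_gcdl m n; have /dvdzP[y nE] := dvdz_gcdr m n.
rewrite -/d in mE nE.
have kE : k = x * y.
  have -> : k = ((x * y * d ^+ 2) %/ d ^+ 2)%Z by rewrite /k {1}mE {1}nE; congr (_ %/ _)%Z; ring.
  by rewrite mulzK // expf_neq0.
have [vv vc _ _] := Kp_completion.
have triple : rad_triple v m n k.
  by rewrite kE; apply: (rad_triple_biquadratic m_sqfree n_sqfree sqrtmE sqrtnE genK
    p_dvd2 Kp_completion d0 mE nE).
have two0 := two_neq0L iota; have v20 := v2_gt0L p_dvd2 Kp_completion.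
have levels a b c : perm_eq [:: a; b; c] [:: m; n; k] -> level_spec s a b c.
  move=> pm; apply: (rad_triple_levels vv two0 v20 vc).
  by apply: (perm3_ind _ _ pm triple);
    [exact: (rad_triple_swap12 vv)|exact: (rad_triple_swap23 vv)].
have [a [b [c [pm cE]]]] : exists a b c : int, perm_eq [:: a; b; c] [:: m; n; k] /\
    [\/ cong4 a b c 3 2 2, cong4 a b c 1 3 3, cong4 a b c 1 2 2 | cong4 a b c 1 1 1].
  have dvd2 : (m %% 2)%Z = 0 -> (n %% 2)%Z = 0 -> (d %% 2)%Z = 0.
    by move=> /dvdz_mod0P m2 /dvdz_mod0P n2; apply/dvdz_mod0P; rewrite dvdz_gcd m2.
  have := biquadratic_mod4 (squarefree_mod4 m_sqfree) (squarefree_mod4 n_sqfree) mE nE dvd2.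
  have P1 : perm_eq [:: n; m; k] [:: m; n; k] by apply/permP => q /=; lia.
  have P2 : perm_eq [:: k; m; n] [:: m; n; k] by apply/permP => q /=; lia.
  rewrite -kE !inE !xpair_eqE -!andbA.
  case/or4P => [/and3P[/eqP m4 /eqP n4 /eqP k4]|/and3P[/eqP m4 /eqP n4 /eqP k4]|
    /and3P[/eqP m4 /eqP n4 /eqP k4]|]; last first.
    case/or4P => [/and3P[/eqP m4 /eqP n4 /eqP k4]|/and3P[/eqP m4 /eqP n4 /eqP k4]|
      /and3P[/eqP m4 /eqP n4 /eqP k4]|]; last first.
      case/or4P => /and3P[/eqP m4 /eqP n4 /eqP k4].
      - by exists m, n, k; split=> //; apply: Or43.
      - by exists n, m, k; split=> //; apply: Or43.
      - by exists k, m, n; split=> //; apply: Or43.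
      - by exists m, n, k; split=> //; apply: Or44.
    - by exists k, m, n; split=> //; apply: Or42.
    - by exists n, m, k; split=> //; apply: Or42.
    - by exists m, n, k; split=> //; apply: Or42.
  - by exists k, m, n; split=> //; apply: Or41.
  - by exists n, m, k; split=> //; apply: Or41.
  - by exists m, n, k; split=> //; apply: Or41.
split; [|by exists a, b, c|exact: levels].
apply: level_spec_mem (levels _ _ _ pm).
by case: cE => -[a4 b4 c4]; [apply: Or41|apply: Or42|apply: Or43|apply: Or44].
Qed.
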